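(* Let $n,s,\ell,c$ be positive integers such that $n=2s+c=3s-\ell$ and $c,\ell\in\{1,\dots,s-1\}$. Then $$e(n,s)=\max\big\{|\mathcal{P}(s,\ell)|,\ |\mathcal{P}'(s,\ell)|,\ |\mathcal{Q}(s,\ell)|,\ |\mathcal{W}(s,\ell)|\big\}.$$ Moreover, if $s\ge 3$ and $\mathcal{F}\subset 2^{[n]}$ is shifted, contains no $s$ pairwise disjoint members, and $|\mathcal{F}|=e(n,s)$, then $\mathcal{F}$ coincides with one of the families $\mathcal{P}(s,\ell),\mathcal{P}'(s,\ell),\mathcal{Q}(s,\ell),\mathcal{W}(s,\ell)$.
   Context: $[n]=\{1,\dots,n\}$, $[a,b]=\{a,a+1,\dots,b\}$ (empty if $b<a$), $\binom{X}{k}$ is the set of $k$-element subsets of $X$, $\binom{X}{\ge k}$ the set of subsets of $X$ of size at least $k$. For a family $\mathcal{F}$, $\nu(\mathcal{F})$ is the maximum number of pairwise disjoint members of $\mathcal{F}$, and $e(n,s)=\max\{|\mathcal{F}|:\mathcal{F}\subset 2^{[n]},\ \nu(\mathcal{F})<s\}$. Define $\mathcal{P}(s,\ell)=\{P\subset[n]: |P|+|P\cap[\ell-1]|\ge 3\}$; $\mathcal{P}'(s,\ell)=\binom{[n]}{\ge 3}\cup\binom{[2\ell-1]}{2}$; $\mathcal{Q}(s,\ell)=\Big(\binom{[n]}{\ge 3}\cup\binom{[s+\ell-1]}{2}\Big)\setminus\binom{[s+\ell,n]}{3}$; $\mathcal{W}(s,\ell)=\{P\subset[n]: |P\cap[2s-1]|\ge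 2\}$. For $i<j$ in $[n]$ and $A\subset[n]$, the shift $S_{i\leftarrow j}(A)$ equals $(A\setminus\{j\})\cup\{i\}$ if $j\in A$ and $i\notin A$, and equals $A$ otherwise. For a family $\mathcal{F}$, $S_{i\leftarrow j}(\mathcal{F})=\{S_{i\leftarrow j}(A):A\in\mathcal{F}\}\cup\{A: A\in\mathcal{F},\ S_{i\leftarrow j}(A)\in\mathcal{F}\}$; $\mathcal{F}$ is shifted if $S_{i\leftarrow j}(\mathcal{F})=\mathcal{F}$ for all $1\le i<j\le n$. *)

(* Defs.v *)
(* The ground set [n] = {1, ..., n} is 'I_n, the ordinal i standing for i.+1. *)
From mathcomp Require Export all_boot.

Set Implicit Arguments.
Unset Strict Implicit.
Unset Printing Implicit Defensive.

(* Subsets are pairwise disjoint exactly when they form a [trivIset];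
   members of G are distinct, and the empty set may be one of them. *)
Definition nu (n : nat) (F : {set {set 'I_n}}) : nat :=
  \max_(G : {set {set 'I_n}} | (G \subset F) && trivIset G) #|G|.

(* For s = 0 no family satisfies nu F < s and the maximum is 0. *)
Definition e (n s : nat) : nat :=
  \max_(F : {set {set 'I_n}} | nu F < s) #|F|.

(* [a, b] as a subset of [n], with the endpoints in 1-based numbering. *)
Definition itv (n a b : nat) : {set 'I_n} := [set i : 'I_n | a <= i.+1 <= b].

Definition ksets (n : nat) (X : {set 'I_n}) (k : nat) : {set {set 'I_n}} :=
  [set A : {set 'I_n} | (A \subset X) && (#|A| == k)].

Definition gesets (n : nat) (X : {set 'I_n}) (k : nat) : {set {set 'I_n}} :=
  [set A : {set 'I_n} | (A \subset X) && (k <= #|A|)].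

(* Each family takes both parameters s and l, even when only one occurs. *)
Definition famP (n s l : nat) : {set {set 'I_n}} :=
  [set P : {set 'I_n} | 3 <= #|P| + #|P :&: itv n 1 (l - 1)|].

Definition famP' (n s l : nat) : {set {set 'I_n}} :=
  gesets (itv n 1 n) 3 :|: ksets (itv n 1 (2 * l - 1)) 2.

Definition famQ (n s l : nat) : {set {set 'I_n}} :=
  (gesets (itv n 1 n) 3 :|: ksets (itv n 1 (s + l - 1)) 2)
    :\: ksets (itv n (s + l) n) 3.

Definition famW (n s l : nat) : {set {set 'I_n}} :=
  [set P : {set 'I_n} | 2 <= #|P :&: itv n 1 (2 * s - 1)|].

Definition shift_set (n : nat) (i j : 'I_n) (A : {set 'I_n}) : {set 'I_n} :=
  if (j \in A) && (i \notin A) then (A :\ j) :|: [set i] else A.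

Definition shift_fam (n : nat) (i j : 'I_n) (F : {set {set 'I_n}}) :
    {set {set 'I_n}} :=
  [set shift_set i j A | A in F] :|: [set A in F | shift_set i j A \in F].

Definition shifted (n : nat) (F : {set {set 'I_n}}) : Prop :=
  forall i j : 'I_n, i < j -> shift_fam i j F = F.

(* Main.v *)
(* Write s = l + c, so that n = 2l + 3c. Maximise |F| and then shift: the extremal F is an
   up-set closed under replacing points by smaller ones. For s >= 3 it contains no
   singleton, for if {0} is in F then either {0} can be traded for two maximal missing sets
   through the last point, or exponentially many sets are missing. If some pair
   {j, 2l-1-j} with j < l is missing, then every pair of F meets [0, j) or lies in
   [0, 2l-1-j), and convexity in j leaves famP and famP'. Otherwise these l nested pairs can
   be completed by c triples to a partition of the ground set, so every choice of triples
   produces missing triples. If the last or last but one point x has at least l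
   neighbours, there are too many missing triples; if it has between 1 and l-1, deleting 0
   and x reduces s by one. If neither has a neighbour, merging the last two points reduces
   c by one: the sets containing exactly one of them account exactly for the growth of the
   number of sets missing from famQ, with equality only for famQ and (when c = 1) famW. *)
Require Import Defs.
From mathcomp Require Import all_boot perm zify.

Set Implicit Arguments.
Unset Strict Implicit.
Unset Printing Implicit Defensive.

(** * Families without s disjoint members, and shifting *)

(** Everything is counted on [~: F]: the numbers missing from [famP], [famP'] and [famQ] are
    polynomials in [l] and [c], whereas the sizes involve [2 ^ n]. [famW] misses
    [(l + c) * 2 ^ (c + 2)] sets, which for [c = 1] is the number for [famQ]; the general lower
    bound applies to it as to any family, so three bounds describe the minimum. The induction is on
    [n]: deleting two points leads from [(l, c)] to [(l - 1, c)], merging to [(l + 1, c - 1)]. It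
    carries only the weak bound, because a reduced family need not be extremal. Strictness must
    therefore come from the count made in each step, and where merging is tight the shape of [F] is
    read off [F] itself, by varying the partition that produces a missing set. Uniqueness starts at
    [s = 3] because for [s = 2] the family of all sets through one point is extremal too. Colourings
    replace subfamilies because they pull back along maps of ground sets. They exclude the empty
    set, which is treated separately at the end. *)

(* [g] colours the ground set; colours [>= s] mark unused points, so this says that
   F has no s indexed pairwise disjoint members (in particular, [set0 \notin F]). *)
Definition nomatch (n : nat) (F : {set {set 'I_n}}) (s : nat) : Prop :=
  forall g : 'I_n -> nat, exists2 i, i < s & [set x | g x == i] \notin F.

Definition upset (n : nat) (F : {set {set 'I_n}}) : Prop :=
  forall A B : {set 'I_n}, A \in F -> A \subset B -> B \in F.

Definition left_closed (n : nat) (F : {set {set 'I_n}}) : Prop :=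
  forall (i j : 'I_n) (A : {set 'I_n}),
    i < j -> A \in F -> j \in A -> i \notin A -> i |: (A :\ j) \in F.

Lemma nomatch_set0 n (F : {set {set 'I_n}}) s :
  nomatch F s -> set0 \notin F.
Proof.
move=> /(_ (fun=> s))[i ltis]; rewrite (_ : [set _ | _] = set0) //.
by apply/setP=> x; rewrite !inE; lia.
Qed.

Lemma nomatch_nu n (F : {set {set 'I_n}}) s : nomatch F s -> nu F < s.
Proof.
move=> nmF; have s_gt0 : 0 < s by have [i] := nmF (fun=> 0); lia.
rewrite -(ltn_predK s_gt0) ltnS; apply/bigmax_leqP => G /andP[sGF tG].
rewrite -ltnS (ltn_predK s_gt0) ltnNge; apply/negP=> lesG.
have [i ltis] := nmF (fun x => index (pblock G x) (enum G)).
case/negP; have ltiG : i < size (enum G) by rewrite -cardE; apply: leq_trans lesG.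
set B := nth set0 (enum G) i.
have BG : B \in G by rewrite -mem_enum mem_nth.
rewrite (_ : [set _ | _] = B); first exact: (subsetP sGF).
apply/setP=> x; rewrite inE; apply/eqP/idP => [ix | xB].
  have /[!mem_enum] pG: pblock G x \in enum G by rewrite -index_mem ix.
  have <- : pblock G x = B by rewrite /B -ix nth_index ?mem_enum.
  apply: contraLR pG => /negPf; rewrite mem_pblock => xG.
  have /eqP-> : pblock G x == set0.
    rewrite -[_ == _]negbK; apply/negP=> /set0Pn[y].
    rewrite /pblock; case: pickP => [C /andP[CG xC] _|_]; last by rewrite inE.
    by move/negP: xG; apply; apply/bigcupP; exists C.
  apply/negP=> G0; have := nomatch_set0 nmF; by rewrite (subsetP sGF).
by rewrite (def_pblock tG BG xB) index_uniq ?enum_uniq.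
Qed.

Lemma nu_nomatch n (F : {set {set 'I_n}}) s :
  set0 \notin F -> nu F < s -> nomatch F s.
Proof.
move=> F0 nuF g.
have [/forallP allF|/forallPn[i iF]] :=
  boolP [forall i : 'I_s, [set x | g x == i] \in F]; last by exists (val i); first exact: ltn_ord.
have nz (i : 'I_s) : exists x, g x = i.
  have : [set x | g x == i] != set0.
    by apply: contraNneq F0 => <-.
  by case/set0Pn=> x; rewrite inE => /eqP; exists x.
pose b (i : 'I_s) := [set x | g x == i].
have binj : injective b.
  move=> i j; have [x gx] := nz i => /setP/(_ x); rewrite !inE gx eqxx.
  by move=> /esym /eqP ij; apply: val_inj.
suff: s <= nu F by lia.
rewrite -[X in X <= _]card_ord -cardsT -(card_imset _ binj).
have := @leq_bigmax_cond {set {set 'I_n}} (fun G => (G \subset F) && trivIset G)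
   (fun G : {set {set 'I_n}} => #|G|) (b @: setT).
apply; apply/andP; split; first by apply/subsetP=> _ /imsetP[i _ ->]; apply: allF.
apply/trivIsetP=> _ _ /imsetP[i _ ->] /imsetP[j _ ->] nij.
rewrite -setI_eq0; apply/eqP/setP=> x; rewrite !inE.
apply/negP=> /andP[/eqP gi /eqP gj]; case/eqP: nij; congr b.
by apply: val_inj; rewrite /= -gi.
Qed.

Lemma nomatch_recolor n (F : {set {set 'I_n}}) s (B : {set 'I_n}) (A : {set 'I_n}) g i :
  [set x | g x == i] = B -> A \subset B -> A \in F -> nomatch F s ->
  exists2 j, j < s & (j != i) && ([set x | g x == j] \notin F).
Proof.
move=> gB sAB AF nmF.
have [j ltjs jF] := nmF (fun x => if (g x == i) && (x \notin A) then s + i else g x).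
have ji : j != i.
  apply: contraNneq jF => ji; rewrite (_ : [set _ | _] = A) //.
  apply/setP=> x; rewrite inE ji.
  have := subsetP sAB x; rewrite -gB inE.
  by case: (g x =P i) => /= [->|gx]; case: (x \in A) => //= h; lia.
exists j => //; rewrite ji; move: jF; rewrite (_ : [set _ | _] = [set x | g x == j]) //.
by apply/setP=> x; rewrite !inE; case: (g x =P i) => //= ->; case: ifP => _; lia.
Qed.

Lemma nomatchU1 n (F : {set {set 'I_n}}) s (A B : {set 'I_n}) :
  nomatch F s -> A \in F -> A \subset B -> nomatch (B |: F) s.
Proof.
move=> nmF AF sAB g.
have [i ltis iF] := nmF g.
have [iB|niB] := boolP ([set x | g x == i] == B); last first.
  by exists i; rewrite // !inE negb_or niB.
have [j ltjs /andP[ji jF]] := nomatch_recolor (eqP iB) sAB AF nmF.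
exists j => //; rewrite !inE negb_or jF andbT.
(* Blocks [i] and [j] are disjoint; if both were [B], then [B] and its subset [A] would be empty. *)
apply: contraNneq (nomatch_set0 nmF) => jB.
suff -> : set0 = A by [].
apply/esym/eqP; rewrite -subset0; apply/subsetP=> x /(subsetP sAB) xB.
have := xB; rewrite -{1}jB !inE => /eqP gj.
by have := xB; rewrite -(eqP iB) inE gj (negPf ji).
Qed.

Section Shift.
Variables (n : nat) (F : {set {set 'I_n}}) (i j : 'I_n).
Hypothesis ltij : i < j.

(** The shift as a map on members: a set whose image is already in [F] stays put, which makes the
    map injective on [F]. *)
Definition shiftb (A : {set 'I_n}) : {set 'I_n} :=
  if [&& j \in A, i \notin A & i |: (A :\ j) \notin F] then i |: (A :\ j) else A.

Lemma card_shiftb : #|shiftb @: F| = #|F|.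
Proof.
apply: card_in_imset => A B AF BF; rewrite /shiftb.
case: ifP => [/and3P[jA iA SA]|_]; case: ifP => [/and3P[jB iB SB]|_] // e; last 2 first.
- by rewrite e BF in SA.
- by rewrite -e AF in SB.
apply/setP=> x; have /setP/(_ x) := e; rewrite !inE.
case: (x =P i) => [->|_] /=; first by rewrite (negPf iA) (negPf iB).
by case: (x =P j) => [->|_] //=; rewrite jA jB.
Qed.

Lemma shift_swap (A : {set 'I_n}) : j \in A -> i \notin A ->
  [set x | tperm i j x \in A] = i |: (A :\ j).
Proof.
move=> jA iA; apply/setP=> x; rewrite !inE; case: tpermP => [->|->|].
- by rewrite jA eqxx.
- by rewrite (negPf iA) eqxx orbF; apply/esym/negbTE; apply: contraTneq jA => ->.
by move=> /eqP/negPf-> /eqP/negPf->.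
Qed.

(** Suppose all blocks lie in the shifted family and one, [k], is new; it contains [i] and not [j].
    Exchanging the colours of [i] and [j] turns block [k] back into its preimage, turns the block of
    [j] into its shift, which is in [F] because that block was not moved, and leaves the others
    alone. All blocks would then be in [F]. *)
Lemma nomatch_shiftb s : nomatch F s -> nomatch (shiftb @: F) s.
Proof.
move=> nmF g.
pose blk (h : 'I_n -> nat) k := [set x | h x == k].
have [/forallP allG|/forallPn[k kF]] :=
  boolP [forall k : 'I_s, blk g k \in shiftb @: F]; last by exists (val k); first exact: ltn_ord.
exfalso.
have inG A : A \in shiftb @: F -> A \notin F ->
    [/\ i \in A, j \notin A & j |: (A :\ i) \in F].
  case/imsetP=> B BF ->; rewrite /shiftb; case: ifP; last by rewrite BF.
  case/and3P=> jB iB SB _; rewrite !inE !eqxx /=.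
  split=> //; first by rewrite orbF; apply: contraTneq jB => ->.
  rewrite (_ : _ |: _ = B) //; apply/setP=> x; rewrite !inE.
  case: (x =P j) => [->|_] /=; first by rewrite jB.
  by case: (x =P i) => [->|_] //=; rewrite (negPf iB).
have inG2 A : A \in shiftb @: F -> j \in A -> i \notin A ->
    A \in F /\ i |: (A :\ j) \in F.
  move=> AG jA iA; have AF : A \in F.
    by apply: contraT => /(inG _ AG)[]; rewrite (negPf iA).
  split=> //; case/imsetP: AG => B BF; rewrite /shiftb.
  case: ifP => [_ eA|]; first by move: iA; rewrite eA !inE eqxx.
  by move=> /negbT + eA; rewrite -eA jA iA /= negbK.
have [k ltks kF] := nmF g.
have kG : blk g k \in shiftb @: F := allG (Ordinal ltks).
have [ik jk SkF] := inG _ kG kF.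
have [m ltms] := nmF (g \o tperm i j); case/negP.
have mG : blk g m \in shiftb @: F := allG (Ordinal ltms).
have -> : [set x | (g \o tperm i j) x == m] = [set x | tperm i j x \in blk g m].
  by apply/setP=> x; rewrite !inE.
have [im|im] := boolP (i \in blk g m).
  have <- : k = m by move: im ik; rewrite !inE => /eqP-> /eqP.
  rewrite -[X in X \in F]/(_) (_ : [set x | _] = j |: (blk g k :\ i)) //.
  apply/setP=> x; rewrite !inE; case: tpermP => [->|->|].
  - move: jk; rewrite inE => /negPf->; rewrite eqxx /= orbF.
    by apply/esym/negP=> /eqP ij; move: ltij; rewrite ij ltnn.
  - by move: ik; rewrite inE => ->; rewrite eqxx.
  by move=> /eqP/negPf-> /eqP/negPf->.
have [jm|jm] := boolP (j \in blk g m).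
  by rewrite shift_swap //; have [] := inG2 _ mG jm im.
rewrite (_ : [set x | _] = blk g m); last first.
  apply/setP=> x; rewrite !inE; case: tpermP => [->|->|] //.
    by move: im jm; rewrite !inE => /negPf-> /negPf->.
  by move: im jm; rewrite !inE => /negPf-> /negPf->.
by apply: contraT => /(inG _ mG)[]; rewrite (negPf im).
Qed.

Definition weight (A : {set 'I_n}) := \sum_(x in A) x.

Lemma weight_shift (A : {set 'I_n}) : j \in A -> i \notin A ->
  weight (i |: (A :\ j)) < weight A.
Proof.
move=> jA iA; rewrite /weight (big_setD1 j jA) big_setU1 /=; last first.
  by rewrite !inE negb_and iA orbT.
by rewrite ltn_add2r.
Qed.

Lemma weight_shiftb (A : {set 'I_n}) : A \in F -> j \in A -> i \notin A ->
  i |: (A :\ j) \notin F ->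
  \sum_(B in shiftb @: F) weight B < \sum_(B in F) weight B.
Proof.
move=> AF jA iA SA.
rewrite big_imset /=; last first.
  by apply/imset_injP/eqP/card_shiftb.
rewrite (bigD1 A) //= [X in _ < X](bigD1 A) //=.
rewrite -addSn leq_add //.
  by rewrite /shiftb jA iA SA /= weight_shift.
apply: leq_sum => B _; rewrite /shiftb; case: ifP => // /and3P[jB iB _].
exact/ltnW/weight_shift.
Qed.

End Shift.

(** Among the families of maximum size, one of least total weight is taken: a missing superset of a
    member could be added, and an effective shift would lower the weight. *)
Lemma extremal_exists n s : 0 < s ->
  exists F : {set {set 'I_n}},
    [/\ nomatch F s, forall G : {set {set 'I_n}}, nomatch G s -> #|G| <= #|F|,
        upset F & left_closed F].
Proof.
move=> s_gt0.
pose ok (F : {set {set 'I_n}}) := (set0 \notin F) && (nu F < s).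
have okP F : reflect (nomatch F s) (ok F).
  apply: (iffP andP) => [[F0 nuF]|nmF]; first exact: nu_nomatch.
  by split; [apply: nomatch_set0 nmF | apply: nomatch_nu].
have ok0 : ok set0.
  by apply/okP=> g; exists 0; rewrite // inE.
have [F1 /okP nm1 max1] := @arg_maxnP _ set0 ok (fun F => #|F|) ok0.
pose ok1 F := ok F && (#|F| == #|F1|).
have ok11 : ok1 F1 by rewrite /ok1 eqxx andbT; apply/okP.
have [F /andP[okF /eqP cF] minF] := @arg_minnP _ F1 ok1
  (fun F => \sum_(B in F) weight B) ok11.
exists F; split.
- exact/okP.
- by move=> G /okP; rewrite cF; apply: max1.
- move=> A B AF sAB; apply: contraT => BF.
  have /okP/max1 : nomatch (B |: F) s by apply: nomatchU1 AF sAB; apply/okP.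
  by rewrite /= cardsU1 BF cF ltnn.
move=> i j A ltij AF jA iA; apply: contraT => SA.
have ok2 : ok1 (shiftb F i j @: F).
  by rewrite /ok1 card_shiftb // cF eqxx andbT; apply/okP/nomatch_shiftb/okP.
have := weight_shiftb ltij AF jA iA SA; rewrite ltnNge; by rewrite (minF _ ok2).
Qed.

(** * Counting missing sets *)

(** Missing sets are listed as increasing lists of numbers, so that their distinctness becomes
    [uniq] of a list of lists. *)
Definition setof (n : nat) (l : seq nat) : {set 'I_n} := [set x : 'I_n | val x \in l].

Lemma eq_setof n l1 l2 : l1 =i l2 -> setof n l1 = setof n l2.
Proof. by move=> e; apply/setP=> x; rewrite !inE e. Qed.

Lemma setof_inj n l1 l2 : sorted ltn l1 -> sorted ltn l2 ->
  all (ltn^~ n) l1 -> all (ltn^~ n) l2 -> setof n l1 = setof n l2 -> l1 = l2.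
Proof.
move=> s1 s2 a1 a2 e; apply: (irr_sorted_eq ltn_trans ltnn) => // x.
apply/idP/idP => xl; have ltxn := allP _ _ xl.
  by have /setP/(_ (Ordinal (ltxn _ a1))) := e; rewrite !inE /= xl.
by have /setP/(_ (Ordinal (ltxn _ a2))) := e; rewrite !inE /= xl.
Qed.

Lemma count_missing_map n n' (F : {set {set 'I_n}}) (F' : {set {set 'I_n'}})
    (phi : {set 'I_n'} -> {set 'I_n}) (L : seq (seq nat)) :
  injective phi -> (forall A, A \notin F' -> phi A \notin F) ->
  uniq L ->
  (forall l, l \in L -> [/\ sorted ltn l, all (ltn^~ n) l, setof n l \notin F &
                         forall A, phi A <> setof n l]) ->
  #|~: F'| + size L <= #|~: F|.
Proof.
move=> phiI phiF uL HL.
rewrite -(card_imset _ phiI).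
have -> : size L = #|[set:: map (setof n) L]|.
  rewrite cardsE (card_uniqP _) ?size_map // map_inj_in_uniq // => l1 l2.
  by move=> /HL[? ? _ _] /HL[? ? _ _]; apply: setof_inj.
rewrite -cardsUI [X in _ + X](_ : _ = 0) ?addn0; last first.
  apply/eqP; rewrite cards_eq0 -subset0; apply/subsetP=> A.
  rewrite !inE => /andP[/imsetP[B _ ->] /mapP[l /HL[_ _ _ /(_ B) nB] e]].
  by case: nB.
apply/subset_leq_card/subsetP=> A; rewrite !inE => /orP[/imsetP[B]|/mapP[l]].
  by rewrite inE => BF' ->; apply: phiF.
by move=> /HL[_ _ lF _] ->.
Qed.

Lemma count_missing n (F : {set {set 'I_n}}) (L : seq (seq nat)) :
  uniq L ->
  (forall l, l \in L -> [/\ sorted ltn l, all (ltn^~ n) l & setof n l \notin F]) ->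
  size L <= #|~: F|.
Proof.
move=> uL HL.
have -> : size L = #|[set:: map (setof n) L]|.
  rewrite cardsE (card_uniqP _) ?size_map // map_inj_in_uniq // => l1 l2.
  by move=> /HL[? ? _] /HL[? ? _]; apply: setof_inj.
by apply/subset_leq_card/subsetP=> A; rewrite !inE => /mapP[l /HL[_ _ lF] ->].
Qed.

Definition pairs (N : nat) : seq (nat * nat) :=
  [seq (u, v) | v <- iota 0 N, u <- iota 0 v].

Lemma mem_pairs N p : (p \in pairs N) = (p.1 < p.2 < N).
Proof.
case: p => u v /=; apply/allpairsPdep/idP => [[v' [u' []]]|].
  by rewrite !mem_iota => ? ? [-> ->]; lia.
by move=> h; exists v, u; rewrite !mem_iota; split=> //; lia.
Qed.

Lemma pairs_uniq N : uniq (pairs N).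
Proof.
apply: allpairs_uniq_dep => [|v _|]; rewrite ?iota_uniq //.
by move=> [v u] [v' u'] _ _ /= [-> ->].
Qed.

Definition npairs N (P : nat -> nat -> bool) := count (fun p => P p.1 p.2) (pairs N).

Lemma pairsS N : pairs N.+1 = pairs N ++ [seq (u, N) | u <- iota 0 N].
Proof.
by rewrite /pairs -[in iota 0 N.+1]addn1 iotaD map_cat flatten_cat /= cats0.
Qed.

Lemma npairsS N P : npairs N.+1 P = npairs N P + count (P^~ N) (iota 0 N).
Proof. by rewrite /npairs pairsS count_cat count_map. Qed.

Lemma leq_npairs N (P Q : nat -> nat -> bool) : (forall u v, u < v < N -> P u v -> Q u v) ->
  npairs N P <= npairs N Q.
Proof.
move=> PQ; rewrite /npairs -!size_filter.
apply: uniq_leq_size => [|p]; first by rewrite filter_uniq ?pairs_uniq.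
by rewrite !mem_filter mem_pairs => /andP[Pp lt]; rewrite lt PQ.
Qed.

Lemma npairs_predC N P : npairs N P + npairs N (fun u v => ~~ P u v) = 'C(N, 2).
Proof.
rewrite /npairs (count_predC (fun p : nat * nat => P p.1 p.2)).
by elim: N => // N IH; rewrite pairsS size_cat IH size_map size_iota binS bin1.
Qed.

Lemma npairs_inj N N' (P Q : nat -> nat -> bool) f :
  (forall u v, u < v < N -> P u v ->
    [/\ (f (u, v)).1 < (f (u, v)).2, (f (u, v)).2 < N' & Q (f (u, v)).1 (f (u, v)).2]) ->
  {in [pred p | p.1 < p.2 < N & P p.1 p.2] &, injective f} -> npairs N P <= npairs N' Q.
Proof.
move=> PQ fI; rewrite /npairs -!size_filter -(size_map f).
apply: uniq_leq_size => [|p].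
  rewrite map_inj_in_uniq ?filter_uniq ?pairs_uniq // => p q.
  by rewrite !mem_filter !mem_pairs => /andP[? ?] /andP[? ?]; apply: fI; apply/andP.
case/mapP=> -[u v]; rewrite mem_filter mem_pairs => /andP[Pp lt] ->.
by rewrite mem_filter mem_pairs; have [-> -> ->] := PQ _ _ lt Pp.
Qed.

Lemma ltn_npairs N (P Q : nat -> nat -> bool) u v :
  (forall u v, u < v < N -> P u v -> Q u v) -> u < v < N -> Q u v -> ~~ P u v ->
  npairs N P < npairs N Q.
Proof.
move=> PQ lt Quv Puv; rewrite /npairs -!size_filter -[_.+1]/(size ((u, v) :: _)).
apply: uniq_leq_size => [|p].
  by rewrite /= mem_filter /= (negPf Puv) filter_uniq ?pairs_uniq.
rewrite inE => /predU1P[->|]; rewrite !mem_filter mem_pairs; first by rewrite Quv lt.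
by move=> /andP[Pp ltp]; rewrite ltp PQ.
Qed.

Lemma count_leq_iota x N : count (leq x) (iota 0 N) = N - x.
Proof.
elim: N => // N IH; rewrite -[in iota 0 N.+1]addn1 iotaD count_cat IH /= add0n addn0.
by case: leqP; lia.
Qed.

Lemma npairs_region x d k :
  2 * npairs ((x + d).+1 + k) (fun u v => (x <= u) && (x + d < v)) = k * (k + 2 * d + 1).
Proof.
elim: k => [|k IH].
  rewrite addn0 mul0n; apply/eqP; rewrite muln_eq0 /=.
  by rewrite /npairs eqn0Ngt -has_count; apply/hasPn => p; rewrite mem_pairs; case: leqP => /=; lia.
rewrite addnS npairsS mulnDr IH.
under eq_count => u do rewrite addSn ltnS leq_addr andbT.
by rewrite count_leq_iota; nia.
Qed.

Lemma npairs_region_eq x y N : x < y -> y <= N ->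
  2 * npairs N (fun u v => (x <= u) && (y <= v)) = (N - y) * (N + y - 1 - 2 * x).
Proof.
move=> xy yN; have := npairs_region x (y - x.+1) (N - y).
rewrite (_ : (_ + _).+1 + _ = N); last by lia.
rewrite (_ : x + (y - x.+1) = y.-1); last by lia.
rewrite (_ : N + y - 1 - 2 * x = N - y + 2 * (y - x.+1) + 1); last by lia.
by rewrite (ltn_predK xy).
Qed.

(** In a left-closed family a missing pair [{x, y}] makes every pair above it coordinatewise
    missing; the left side is twice the number of pairs in that region. *)
Lemma npairs_region_bound x y N (P : nat -> nat -> bool) : x < y -> y <= N ->
  (forall u v, x <= u -> y <= v -> u < v < N -> P u v) ->
  (N - y) * (N + y - 1 - 2 * x) <= 2 * npairs N P.
Proof.
move=> xy yN HP; rewrite -npairs_region_eq // leq_pmul2l //.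
by apply: leq_npairs => u v lt /andP[xu yv]; apply: HP.
Qed.

Section Families.
Variables (n : nat) (F : {set {set 'I_n}}).
Hypotheses (upF : upset F) (lcF : left_closed F).

Lemma setof_sub l1 l2 : {subset l1 <= l2} -> setof n l1 \in F -> setof n l2 \in F.
Proof.
move=> s12 l1F; apply: upF l1F _.
by apply/subsetP=> x; rewrite !inE; apply: s12.
Qed.

Lemma setof_shift a a' r : a < n -> a' <= a -> a \notin r -> a' \notin r ->
  setof n (a :: r) \in F -> setof n (a' :: r) \in F.
Proof.
move=> ltan; rewrite leq_eqVlt => /predU1P[-> //|lt] ar a'r aF.
have lta'n : a' < n by lia.
have := @lcF (Ordinal lta'n) (Ordinal ltan) _ lt aF.
rewrite !inE eqxx /= => /(_ isT); rewrite negb_or a'r andbT neq_ltn lt => /(_ isT).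
congr (_ \in F); apply/setP=> x; rewrite !inE -!val_eqE /=.
by case: (val x =P a) => [->|_] //=; rewrite (negPf ar).
Qed.

Definition pairin a b := setof n [:: a; b] \in F.
Definition triplein a b c := setof n [:: a; b; c] \in F.

Lemma pairin_mono a b a' b' : pairin a b -> a' <= a -> b' <= b -> a' < b' -> a < b < n -> pairin a' b'.
Proof.
move=> Eab la lb lt ltn; rewrite /pairin.
have E1 : setof n [:: a'; b] \in F by apply: setof_shift Eab; rewrite ?inE; lia.
have E2 : setof n [:: b; a'] \in F by rewrite (@eq_setof _ _ [:: a'; b]) // => x; rewrite !inE orbC.
have E3 : setof n [:: b'; a'] \in F by apply: setof_shift E2; rewrite ?inE; lia.
by rewrite (@eq_setof _ _ [:: b'; a']) // => x; rewrite !inE orbC.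
Qed.

Lemma triplein_mono a b c a' b' c' : triplein a b c -> a' <= a -> b' <= b -> c' <= c ->
  a' < b' < c' -> a < b < c -> c < n -> triplein a' b' c'.
Proof.
move=> Tabc la lb lc lt lt' ltn; rewrite /triplein.
have E1 : setof n [:: a'; b; c] \in F by apply: setof_shift Tabc; rewrite ?inE; lia.
have E2 : setof n [:: b; a'; c] \in F.
  by rewrite (@eq_setof _ _ [:: a'; b; c]) // => x; rewrite !inE orbCA.
have E3 : setof n [:: b'; a'; c] \in F by apply: setof_shift E2; rewrite ?inE; lia.
have E4 : setof n [:: c; b'; a'] \in F.
  by rewrite (@eq_setof _ _ [:: b'; a'; c]) // => x; rewrite !inE; lia.
have E5 : setof n [:: c'; b'; a'] \in F by apply: setof_shift E4; rewrite ?inE; lia.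
by rewrite (@eq_setof _ _ [:: c'; b'; a']) // => x; rewrite !inE; lia.
Qed.

(** The form in which the hypothesis is used below: since [F] is an up-set, the missing block
    contains no member, so only those of its points that matter have to be named. *)
Lemma nomatch_col s h : nomatch F s ->
  exists2 i, i < s & forall l, all (fun x => h x == i) l -> setof n l \notin F.
Proof.
move=> nmF; have [i ltis iF] := nmF (fun x : 'I_n => h x); exists i => // l /allP hl.
apply: contraNN iF => lF; apply: upF lF _.
by apply/subsetP=> x; rewrite !inE => /hl.
Qed.

End Families.

(** * Arithmetic of the bounds *)

(* Twice the number of sets missing from [famP] and [famP'], and three times the number
   missing from [famQ], when s = l + c and n = 2 l + 3 c. *)
Definition boundP (l c : nat) := 2 * (1 + 2 * l + 3 * c) + (l + 3 * c + 1) * (l + 3 * c).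
Definition boundP' (l c : nat) := 2 * (1 + 2 * l + 3 * c) + (3 * c + 1) * (4 * l + 3 * c - 2).
Definition boundQ (l c : nat) := 12 * (l + c) * (c + 1) + 4 * c * (c * c - 1).

Definition ge_min (l c y : nat) : Prop :=
  [\/ boundP l c <= 2 * y, boundP' l c <= 2 * y | boundQ l c <= 3 * y].

Definition gt_min (l c y : nat) : Prop :=
  [\/ boundP l c < 2 * y, boundP' l c < 2 * y | boundQ l c < 3 * y].

Lemma gt_minW l c y : gt_min l c y -> ge_min l c y.
Proof. by case=> /ltnW; [apply: Or31|apply: Or32|apply: Or33]. Qed.

Lemma ge_min_leq l c y y' : y <= y' -> ge_min l c y -> ge_min l c y'.
Proof. by move=> le [h|h|h]; [apply: Or31|apply: Or32|apply: Or33]; apply: leq_trans h _; lia. Qed.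

Lemma boundP_leQ p q : 3 * boundP (1 + p) (1 + p + q) <= 2 * boundQ (1 + p) (1 + p + q).
Proof. by rewrite /boundP /boundQ; lia. Qed.

(** With [l = p + 1] and [c = q], the difference of the two sides is (l - 1)(6c + 2 - l). *)
Lemma boundP_leP' p q : p <= 6 * q + 1 -> boundP p.+1 q <= boundP' p.+1 q.
Proof. by rewrite /boundP /boundP'; nia. Qed.

(** From [l] to [l + 1] the number missing from [famP] grows by l + 3c + 3, that from [famP'] by 6c
    + 4 and that from [famQ] by 4c + 4. The last two stay below the increment l + 3c + 4 only for l
    > 3c and l > c respectively; otherwise the hypothesis is first weakened to the bound for
    [famP]. *)
Lemma gt_min_remove l c y y' : 0 < l -> ge_min l c y' -> y' + (l + 3 * c + 4) <= y -> gt_min l.+1 c y.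
Proof.
move=> l_gt0 [h|h|h] hy.
- apply: Or31; move: h; rewrite /boundP; nia.
- case: (leqP l (3 * c)) => lc.
    have h' : boundP l c <= 2 * y'.
      by apply: leq_trans h; rewrite -(ltn_predK l_gt0); apply: boundP_leP'; lia.
    by apply: Or31; move: h'; rewrite /boundP; nia.
  by apply: Or32; move: h; rewrite /boundP'; nia.
- case: (leqP l c) => lc.
    have h' : 3 * boundP l c <= 6 * y'.
      have := boundP_leQ l.-1 (c - l); rewrite (_ : 1 + _ = l); last by lia.
      by rewrite (_ : l + _ = c); lia.
    by apply: Or31; move: h'; rewrite /boundP; nia.
  by apply: Or33; move: h; rewrite /boundQ; nia.
Qed.

Lemma ge_min_merge l c y y' : 0 < l -> 3 <= l + c.+1 -> ge_min l.+1 c y' ->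
  y' + 4 * (l + c.+1) + 4 * c.+1 * c <= y -> ge_min l c.+1 y.
Proof.
move=> l_gt0 s_ge3 [h|h|h] hy.
- apply: Or31; move: h; rewrite /boundP; nia.
(* The number missing from [famP'] grows by 6l + 3c + 2, which is at most the increment exactly in
   this case. For larger [l] the bound for [famQ] at [(l + 1, c)] follows already, and its growth
   equals the increment. *)
- have [lc|lc] := leqP (2 * (l + c.+1)) (4 * c.+1 * c.+1 - c).
    by apply: Or32; move: h; rewrite /boundP'; nia.
  apply: Or33; have {h} : boundQ l.+1 c <= 3 * y' by move: h; rewrite /boundP' /boundQ; nia.
  by rewrite /boundQ; nia.
- by apply: Or33; move: h; rewrite /boundQ; nia.
Qed.

Lemma gt_min_merge l c y y' : 0 < l -> 3 <= l + c.+1 -> ge_min l.+1 c y' ->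
  y' + 4 * (l + c.+1) + 4 * c.+1 * c < y -> gt_min l c.+1 y.
Proof.
move=> l_gt0 s_ge3 gd hy.
have y_gt0 : 0 < y by lia.
have : ge_min l c.+1 y.-1 by apply: ge_min_merge gd _ => //; lia.
by case=> h; [apply: Or31|apply: Or32|apply: Or33]; apply: leq_ltn_trans h _; lia.
Qed.

(** The left side is a concave quadratic in [j], equal to [boundP'] at [j = 0] and to [boundP] at
    [j = l - 1]. The case split decides which endpoint value is exceeded. *)
Lemma interior_bound l c j y : 0 < j -> j < l - 1 ->
  2 * (1 + 2 * l + 3 * c) + (3 * c + 1 + j) * (4 * l + 3 * c - 2 - 3 * j) <= 2 * y ->
  gt_min l c y.
Proof.
move=> j_gt0 ltj h.
have [hj|hj] := leqP (4 * l) (6 * c + 5 + 3 * j).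
  by apply: Or31; apply: leq_trans h; rewrite /boundP; nia.
by apply: Or32; apply: leq_trans h; rewrite /boundP'; nia.
Qed.

(** The right side is concave in [p] and equals the left side at [p = 0]: the innermost triple is
    the least favourable one. *)
Lemma star_arith1 K p : 2 * p + 2 <= K ->
  2 * (K * K) <= (K - p) * (K + 1 + 3 * p) + (K - 1 - p) * (K + 3 * p).
Proof. 
move=> h; have [r ->] : exists r, K = 2 * p + 2 + r by exists (K - (2 * p + 2)); lia.
rewrite (_ : _ - p = p + 2 + r); last by lia.
rewrite (_ : _ - 1 - p = p + 1 + r); last by lia.
nia. Qed.
Lemma star_arith2 l c t : 0 < l -> 3 <= l + c -> t < c ->
  (l + 3 * c + 1) * (l + 3 * c) < (l + c + 1 + t) * (l + 5 * c - 2 - 3 * t) +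
  2 * ((l + 2 * c - 1) * (l + 2 * c - 1)).
Proof.
move=> l0 s3 tc; have [L eL] : exists L, l = L.+1 by exists l.-1; lia.
have [u eu] : exists u, c = t + 1 + u by exists (c - t - 1); lia. subst l c.
rewrite (_ : _ - 2 - 3 * t = L + 2 * t + 5 * u + 4); last by lia.
rewrite (_ : _ - 1 = L + 2 * t + 2 * u + 2); last by lia.
nia. Qed.
Lemma star_arith3 l c t : 0 < l -> 3 <= l + c -> t < c ->
  (l + 3 * c + 1) * (l + 3 * c) <
  2 * (2 * l + 3 * c - 1) + (l + c + t) * (l + 5 * c - 3 - 3 * t) + (l + c) * (l + 5 * c - 3).
Proof.
move=> l0 s3 tc; have [L eL] : exists L, l = L.+1 by exists l.-1; lia.
have [u eu] : exists u, c = t + 1 + u by exists (c - t - 1); lia. subst l c.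
rewrite (_ : _ - 3 - 3 * t = L + 2 * t + 5 * u + 3); last by lia.
rewrite (_ : _ - 1 = 2 * L + 3 * t + 3 * u + 4); last by lia.
rewrite (_ : _ - 3 = L + 5 * t + 5 * u + 3); last by lia.
nia. Qed.
Lemma star_arith4 s K c : K + 1 = s + c -> c < s ->
  s * (s + 4 * c - 3) <= 2 * (K * K).
Proof. 
move=> e h; have [L eL] : exists L, s = c + L.+1 by exists (s - c - 1); lia. 
case: c e h eL => [|c] e h eL.
  have -> : K = L by lia.
  rewrite {}eL (_ : _ - 3 = L - 2); last by lia. nia.
have -> : K = 2 * c + L + 2 by lia.
rewrite {}eL (_ : _ - 3 = 5 * c + L + 3); last by lia.
nia. Qed.

(** * Singletons *)

(** [boundP] at most doubles when [l] grows by one and at most quadruples when [c] does. At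
    [l = c = 1] both sides are 32, so strictness begins with [s = 3]. *)
Lemma boundP_exp l c : 0 < l -> 3 <= l + c -> boundP l c < 2 ^ (l + 2 * c + 2).
Proof.
move: {2}(l + c - 3) (erefl (l + c - 3)) => k; elim: k l c => [|k IH] l c.
  move=> hk l_gt0 lc3.
  have : [|| (l == 3) && (c == 0), (l == 2) && (c == 1) | (l == 1) && (c == 2)] by lia.
  by case/or3P=> /andP[/eqP-> /eqP->].
move=> hk l_gt0 lc3; case: (posnP c) => [c0|c_gt0].
  have h : boundP l.-1 c < 2 ^ (l.-1 + 2 * c + 2) by apply: IH; lia.
  rewrite (_ : l + 2 * c + 2 = (l.-1 + 2 * c + 2).+1) ?expnS; last by lia.
  have : boundP l c <= 2 * boundP l.-1 c by rewrite /boundP; nia.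
  by lia.
have h : boundP l c.-1 < 2 ^ (l + 2 * c.-1 + 2) by apply: IH; lia.
rewrite (_ : l + 2 * c + 2 = (l + 2 * c.-1 + 2).+2) ?expnS; last by lia.
have : boundP l c <= 2 * (2 * boundP l c.-1) by rewrite /boundP; nia.
by lia.
Qed.

Lemma card_sets n : #|{set 'I_n}| = 2 ^ n.
Proof. by rewrite -cardsT -powersetT card_powerset cardsT card_ord. Qed.

Lemma nomatch2_bound n (F : {set {set 'I_n}}) : nomatch F 2 -> 2 ^ n <= 2 * #|~: F|.
Proof.
move=> nmF; suff : #|F| <= #|~: F|.
  by have := cardsC F; rewrite card_sets; lia.
rewrite -(card_imset _ (inv_inj (@setCK _))); apply/subset_leq_card/subsetP.
move=> _ /imsetP[A AF ->]; rewrite inE.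
have [i lti2] := nmF (fun x => (x \notin A : nat)).
case: i lti2 => [|[|//]] _.
  rewrite (_ : [set x | _] = A) ?AF //; apply/setP=> x; rewrite !inE.
  by case: (x \in A).
congr (_ \notin F); apply/setP=> x; rewrite !inE; by case: (x \in A).
Qed.

Lemma nomatch1_bound n (F : {set {set 'I_n}}) : nomatch F 1 -> 2 ^ n = #|~: F|.
Proof.
move=> nmF; suff -> : F = set0 by rewrite setC0 cardsT card_sets.
apply/setP=> A; rewrite [RHS]inE; apply/negP=> AF.
have [[|//] _] := nmF (fun x => (x \notin A : nat)).
rewrite (_ : [set x | _] = A) ?AF //; apply/setP=> x; rewrite !inE.
by case: (x \in A).
Qed.

(** For [s = 1] the family is empty, and for [s = 2] it omits the complement of each member;
    [boundP] takes exactly the resulting values. *)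
Lemma ge_min_small n l c (F : {set {set 'I_n}}) :
  n = 2 * l + 3 * c -> 0 < l -> l + c < 3 -> nomatch F (l + c) -> ge_min l c #|~: F|.
Proof.
move=> n_eq l_gt0 lc3 nmF; apply: Or31.
have : [|| (l == 1) && (c == 0), (l == 2) && (c == 0) | (l == 1) && (c == 1)] by lia.
case/or3P=> /andP[/eqP el /eqP ec]; subst l c.
- by have := nomatch1_bound nmF; rewrite {1}n_eq => <-.
- by have := nomatch2_bound nmF; rewrite {1}n_eq /boundP; lia.
- by have := nomatch2_bound nmF; rewrite {1}n_eq /boundP; lia.
Qed.

Section NoSingleton.
Variables (n s : nat) (F : {set {set 'I_n}}).
Hypotheses (nmF : nomatch F s) (upF : upset F) (lcF : left_closed F).
Hypothesis maxF : forall G : {set {set 'I_n}}, nomatch G s -> #|G| <= #|F|.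
Hypothesis le2sn : 2 * s <= n.

Lemma nomatch_nested : ~ (forall i, i < s -> pairin F i (2 * s - 1 - i)).
Proof.
move=> nest.
have [i ltis miss] :=
  nomatch_col upF (fun y => if y < s then y else 2 * s - 1 - y) nmF.
have /negP[] : setof n [:: i; 2 * s - 1 - i] \notin F by apply: miss; rewrite /= ltis; case: ifP; lia.
exact: nest.
Qed.

Hypothesis s_gt0 : 0 < s.

Lemma last_notin : setof n [:: n.-1] \notin F.
Proof.
apply/negP=> lF.
have [i ltis miss] := nomatch_col upF id nmF.
have /negP[] : setof n [:: i] \notin F by apply: miss; rewrite /= eqxx.
by apply: setof_shift lF => //; lia.
Qed.

Hypothesis zeroF : setof n [:: 0] \in F.

Lemma zero_in (A : {set 'I_n}) (x : 'I_n) : val x = 0 -> x \in A -> A \in F.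
Proof.
move=> x0 xA; apply: upF zeroF _; apply/subsetP=> y.
rewrite !inE -[0]x0 => /eqP yx.
by rewrite (val_inj yx).
Qed.

(* With {0} in F, a block that is a maximal missing set can be repaired by moving one
   point out of the block of 0, which stays in F as long as it contains 0. *)
Lemma max_missing_recolor (B : {set 'I_n}) g i : i < s ->
  maxset (fun A => A \notin F) B -> [set x | g x == i] = B ->
  (forall j, j < s -> j != i ->
     [set x | g x == j] \in F /\ [set x | g x == j] <> setof n [:: 0]) -> False.
Proof.
move=> ltis /maxsetP[BF maxB] gB others.
have n_gt0 : 0 < n by lia.
pose z : 'I_n := Ordinal n_gt0.
have zB : z \notin B by apply: contraNN BF; apply: zero_in.
have [|] := leqP s (g z) => [lesz|ltzs].
  have [k ltks] := nmF (fun y => if y == z then i else g y).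
  have [->|ki] := eqVneq k i; first by case/negP; apply: (@zero_in _ z); rewrite // inE eqxx.
  case/negP; rewrite (_ : [set _ | _] = [set x | g x == k]); first by have [] := others k.
  by apply/setP=> y; rewrite !inE; case: (y =P z) => [->|]; lia.
have gzi : g z != i by apply: contraNneq zB => gzi; rewrite -gB inE gzi.
have [gzF gz0] := others _ ltzs gzi.
have [x xz gx] : exists2 x, x != z & g x = g z.
  have [/existsP[x /andP[xz /eqP gx]]|/existsPn H] := boolP [exists x, (x != z) && (g x == g z)].
    by exists x.
  case: gz0; apply/setP=> x; rewrite !inE; apply/eqP/eqP => [gx|x0].
    by have := H x; rewrite gx eqxx andbT negbK => /eqP->.
  by congr g; apply: val_inj.
have [k ltks] := nmF (fun y => if y == x then i else g y); case/negP.
have [->|ki] := eqVneq k i.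
  apply: contraT => nF.
  have xBs : x \in B.
    rewrite -(maxB _ nF); first by rewrite inE eqxx.
    by apply/subsetP=> y; rewrite -gB !inE => /eqP gy; case: ifP => // _; apply/eqP.
  by move: xBs gzi; rewrite -gB inE gx => /eqP->; rewrite eqxx.
have [->|kz] := eqVneq k (g z).
  by apply: (@zero_in _ z); rewrite // inE [z == x]eq_sym (negPf xz).
rewrite (_ : [set _ | _] = [set y | g y == k]); first by have [] := others k.
apply/setP=> y; rewrite !inE; case: (y =P x) => [->|//].
by rewrite gx eq_sym (negPf ki) eq_sym (negPf kz).
Qed.

(* Otherwise trading {0} for both B and B' would enlarge F. *)
Lemma max_missing_uniq (B B' : {set 'I_n}) (z : 'I_n) :
  z \in B -> z \in B' -> maxset (fun A => A \notin F) B ->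
  maxset (fun A => A \notin F) B' -> B = B'.
Proof.
move=> zB zB' maxB maxB'; apply/eqP; apply: contraT => neB.
have BF := maxsetp maxB; have BF' := maxsetp maxB'.
pose G := B |: (B' |: (F :\ setof n [:: 0])).
suff /maxF : nomatch G s.
  rewrite /= /G !cardsU1 !inE (negPf neB) (negPf BF) (negPf BF') !andbF /=.
  by have := cardsD1 (setof n [:: 0]) F; rewrite zeroF => ->; rewrite leq_add2l ltnn.
move=> g.
have [/forallP allG|/forallPn[k kF]] :=
  boolP [forall k : 'I_s, [set x | g x == k] \in G]; last by exists (val k); first exact: ltn_ord.
exfalso; have {}allG j : j < s -> [set x | g x == j] \in G.
  by move=> lt; apply: (allG (Ordinal lt)).
have [i ltis iF] := nmF g.
have bi : maxset (fun A => A \notin F) [set x | g x == i] /\ z \in [set x | g x == i].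
  by have := allG _ ltis; rewrite !in_setU1 in_setD1 (negPf iF) andbF orbF => /orP[] /eqP->.
apply: (max_missing_recolor ltis bi.1 erefl) => j ltjs ji.
have nz : z \notin [set x | g x == j].
  by move: bi.2; rewrite !inE => /eqP->; rewrite eq_sym.
have := allG _ ltjs; rewrite !in_setU1 in_setD1 => /or3P[/eqP e|/eqP e|/andP[/eqP ? ?]] //.
  by rewrite e zB in nz.
by rewrite e zB' in nz.
Qed.

(** By uniqueness one maximal missing set [B] contains all missing sets through the last point, and
    all subsets of [B] are missing. If [B] were smaller, some [x >= s - 1] would lie outside it;
    then [{x, n - 1}] is in [F] and shifts to all [s] nested pairs. *)
Lemma singleton_missing_bound : 2 ^ (n - s + 1) <= #|~: F|.
Proof.
have ltn1 : n.-1 < n by lia.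
pose z : 'I_n := Ordinal ltn1.
have [B maxB szB] := @maxset_exists _ (fun A => A \notin F) _ last_notin.
have zB : z \in B by apply: (subsetP szB); rewrite !inE.
have sub A : A \notin F -> z \in A -> A \subset B.
  move=> AF zA; have [B' maxB' sAB'] := @maxset_exists _ (fun A => A \notin F) _ AF.
  by rewrite (max_missing_uniq zB (subsetP sAB' _ zA) maxB maxB').
suff cB : n - s + 1 <= #|B|.
  apply: leq_trans (leq_pexp2l _ cB) _ => //.
  rewrite -card_powerset; apply/subset_leq_card/subsetP=> A; rewrite !inE => sAB.
  by apply: contraNN (maxsetp maxB) => AF; apply: upF AF sAB.
rewrite leqNgt; apply/negP=> ltB.
have [x xB lex] : exists2 x : 'I_n, x \notin B & s - 1 <= x.
  have [/existsP[x /andP[xB lx]]|/existsPn H] := boolP [exists x : 'I_n, (x \notin B) && (s - 1 <= x)].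
    by exists x.
  have : #|~: B| <= s - 1.
    rewrite cardE -(size_map val) -[X in _ <= X](size_iota 0).
    apply: uniq_leq_size => [|v /mapP[x]]; first by rewrite (map_inj_uniq val_inj) enum_uniq.
    rewrite mem_enum inE => xB ->; rewrite mem_iota.
    by have := H x; rewrite xB /= -ltnNge.
  by have := cardsC B; rewrite card_ord; lia.
have ltxn : x < n.-1.
  have := ltn_ord x; suff : x <> n.-1 :> nat by lia.
  by move=> e; move: xB; rewrite (_ : x = z) ?zB //; apply: val_inj.
apply: nomatch_nested => i ltis.
have Ex : pairin F x n.-1.
  apply: contraT => /sub; rewrite inE /= !inE eqxx orbT => /(_ isT)/subsetP/(_ x).
  by rewrite !inE eqxx (negPf xB) => /(_ isT).
by apply: (pairin_mono lcF Ex); lia.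
Qed.

End NoSingleton.

(** * Merging and deleting points *)

Lemma nomatch_preim n n' (F : {set {set 'I_n}}) s (f : 'I_n -> 'I_n') :
  nomatch F s -> nomatch [set A : {set 'I_n'} | f @^-1: A \in F] s.
Proof.
move=> nmF g; have [i ltis iF] := nmF (g \o f); exists i => //.
rewrite inE; move: iF; rewrite (_ : [set x | _] = f @^-1: [set x | g x == i]) //.
by apply/setP=> x; rewrite !inE.
Qed.

(** All points outside the image of [f] get colour [s]; they include [a] and [b], so block [s]
    contains a member and the missing block is one of the others. *)
Lemma nomatch_remove n n' (F : {set {set 'I_n}}) s (f : 'I_n' -> 'I_n) a b :
  upset F -> injective f -> pairin F a b ->
  (forall x, val (f x) <> a /\ val (f x) <> b) ->
  nomatch F s.+1 -> nomatch [set A : {set 'I_n'} | f @: A \in F] s.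
Proof.
move=> upF fI Eab fab nmF g.
have [i] := nmF (fun x => if [pick y | f y == x] is Some y then g y else s).
rewrite ltnS leq_eqVlt => /predU1P[-> /negP[]|ltis iF].
  apply: upF Eab _; apply/subsetP=> x; rewrite !inE => xab.
  case: pickP => [y /eqP yx|]; last by rewrite eqxx.
  by have [ya yb] := fab y; move: xab; rewrite -yx => /orP[]/eqP.
exists i => //; rewrite inE; move: iF.
rewrite (_ : [set x | _] = f @: [set x | g x == i]) //.
apply/setP=> x; rewrite inE; apply/eqP/imsetP => [|[y + ->]]; last first.
  rewrite inE; case: pickP => [z /eqP /fI->|/(_ y)]; last by rewrite eqxx.
  by move/eqP.
by case: pickP => [y /eqP <- gy|_ si]; [exists y; rewrite // inE gy | lia].
Qed.

Section LeftClosed.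
Variables (n : nat) (F : {set {set 'I_n}}).
Hypothesis lcF : left_closed F.

Lemma count_missE j k : ~~ pairin F j k -> j < k -> k <= n ->
  (n - k) * (n + k - 1 - 2 * j) <= 2 * npairs n (fun u v => ~~ pairin F u v).
Proof.
move=> nE jk kn; apply: npairs_region_bound => // u v ju kv lt.
by apply: contraNN nE => h; apply: (pairin_mono lcF h); lia.
Qed.

Lemma count_missT a b w w' : ~~ triplein F a b w' -> a < b -> b < w' -> w' <= w -> w < n ->
  (w - b) * (w + b - 1 - 2 * a) <= 2 * npairs w (fun u v => ~~ triplein F u v w).
Proof.
move=> nT ab bw ww wn; apply: npairs_region_bound => [//||u v au bv lt]; first by lia.
by apply: contraNN nT => h; apply: (triplein_mono lcF h); lia.
Qed.

End LeftClosed.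

Section Counts.
Variables (n : nat) (F : {set {set 'I_n}}).
Hypotheses (upF : upset F) (lcF : left_closed F) (noF1 : setof n [:: 0] \notin F).
Hypothesis n_gt0 : 0 < n.

Lemma setof0_notin : setof n [::] \notin F.
Proof. by apply: contraNN noF1; apply: setof_sub. Qed.

Lemma setof1_notin a : a < n -> setof n [:: a] \notin F.
Proof. by move=> ltan; apply: contraNN noF1; apply: setof_shift. Qed.

(** Among the triples only those whose largest point is [n - 1] or [n - 2] are counted; with the
    smaller sets they suffice for every direct estimate. *)
Lemma count_direct :
  1 + n + npairs n (fun u v => ~~ pairin F u v)
    + (npairs n.-1 (fun u v => ~~ triplein F u v n.-1) + npairs n.-2 (fun u v => ~~ triplein F u v n.-2))
  <= #|~: F|.
Proof.
pose L := [:: [::]] ++ [seq [:: a] | a <- iota 0 n]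
   ++ [seq [:: p.1; p.2] | p <- [seq p <- pairs n | ~~ pairin F p.1 p.2]]
   ++ [seq [:: p.1; p.2; n.-1] | p <- [seq p <- pairs n.-1 | ~~ triplein F p.1 p.2 n.-1]]
   ++ [seq [:: p.1; p.2; n.-2] | p <- [seq p <- pairs n.-2 | ~~ triplein F p.1 p.2 n.-2]].
have -> : 1 + n + npairs n (fun u v => ~~ pairin F u v)
    + (npairs n.-1 (fun u v => ~~ triplein F u v n.-1) + npairs n.-2 (fun u v => ~~ triplein F u v n.-2))
    = size L by rewrite /L !size_cat !size_map size_iota !size_filter !addnA.
apply: count_missing => [|x].
  rewrite /L !cat_uniq -!all_predC !map_inj_uniq ?iota_uniq ?filter_uniq ?pairs_uniq //=.
  - rewrite andbT; apply/and4P; split.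
    + by apply/allP=> x; rewrite !mem_cat inE => /or4P[] /mapP[y _ ->].
    + apply/allP=> x; rewrite !mem_cat /= => h; apply/negP=> /mapP[y _ e]; move: h.
      by rewrite e => /or3P[] /mapP[].
    + apply/allP=> x; rewrite !mem_cat /= => h; apply/negP=> /mapP[y _ e]; move: h.
      by rewrite e => /orP[] /mapP[].
    apply/allP=> x /mapP[p]; rewrite mem_filter mem_pairs => /andP[_ lt] ->.
    by apply/negP=> /mapP[q _ [_ _]]; lia.
  - by move=> [u v] [u' v'] /= [-> ->].
  - by move=> [u v] [u' v'] /= [-> ->].
  - by move=> [u v] [u' v'] /= [-> ->].
  by move=> a b [->].
rewrite !mem_cat inE => /orP[/eqP->|]; first by split=> //; exact: setof0_notin.
case/or4P=> /mapP[y].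
- rewrite mem_iota add0n => /= ltyn ->.
  by split; rewrite //= ?andbT // setof1_notin.
- by case: y => u v; rewrite mem_filter mem_pairs /= => /andP[nE lt] ->; split; [rewrite /=; lia | rewrite /=; lia | exact: nE].
- by case: y => u v; rewrite mem_filter mem_pairs /= => /andP[nE lt] ->; split; [rewrite /=; lia | rewrite /=; lia | exact: nE].
by case: y => u v; rewrite mem_filter mem_pairs /= => /andP[nE lt] ->; split; [rewrite /=; lia | rewrite /=; lia | exact: nE].
Qed.

End Counts.

Section Merge.
Variables (n' : nat).
Hypothesis n'_gt1 : 1 < n'.

Lemma merge_subproof (x : 'I_n'.+1) : minn x n'.-1 < n'.
Proof. lia. Qed.
Definition merge (x : 'I_n'.+1) : 'I_n' := Ordinal (merge_subproof x).

Lemma preim_merge_inj : injective (fun A : {set 'I_n'} => merge @^-1: A).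
Proof.
move=> A B /setP eAB; apply/setP=> x.
have := eAB (widen_ord (leqnSn n') x); rewrite !inE.
rewrite (_ : merge _ = x) //; apply: val_inj => /=; have := ltn_ord x; lia.
Qed.

(** Preimages under [merge] contain both or neither of the last two points, so missing sets with
    exactly one of them are new. As [{0, n' - 1}] is missing, these include 2 singletons and 2(n' -
    1) pairs, which make up [2 * n']. *)
Lemma merge_count (F : {set {set 'I_n'.+1}}) :
  upset F -> left_closed F -> setof _ [:: 0] \notin F -> ~~ pairin F 0 n'.-1 ->
  #|~: [set A : {set 'I_n'} | merge @^-1: A \in F]| + (2 * n' +
    (npairs n'.-1 (fun u v => ~~ triplein F u v n') + npairs n'.-1 (fun u v => ~~ triplein F u v n'.-1)))
  <= #|~: F|.
Proof.
move=> upF lcF F1 nE.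
have nEa a : a < n'.-1 -> ~~ pairin F a n'.-1 /\ ~~ pairin F a n'.
  by move=> lt; split; apply: contraNN nE => h; apply: (pairin_mono lcF h); lia.
pose L := [:: [:: n']; [:: n'.-1]] ++ [seq [:: a; n'] | a <- iota 0 n'.-1]
   ++ [seq [:: a; n'.-1] | a <- iota 0 n'.-1]
   ++ [seq [:: p.1; p.2; n'] | p <- [seq p <- pairs n'.-1 | ~~ triplein F p.1 p.2 n']]
   ++ [seq [:: p.1; p.2; n'.-1] | p <- [seq p <- pairs n'.-1 | ~~ triplein F p.1 p.2 n'.-1]].
have -> : 2 * n' + (npairs n'.-1 (fun u v => ~~ triplein F u v n') + npairs n'.-1 (fun u v => ~~ triplein F u v n'.-1))
    = size L by rewrite /L !size_cat !size_map !size_iota !size_filter /= /npairs; lia.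
apply: count_missing_map => [|A||x]; [exact: preim_merge_inj|by rewrite inE| |].
  rewrite /L !cat_uniq -!all_predC !map_inj_uniq ?iota_uniq ?filter_uniq ?pairs_uniq //=.
  - rewrite !andbT; apply/and5P; split.
    + rewrite inE; apply/eqP => -[]; lia.
    + by apply/allP=> x; rewrite !mem_cat => /or4P[] /mapP[y _ ->]; rewrite /= !inE !eqseq_cons !andbF.
    + apply/allP=> x; rewrite !mem_cat /= => h; apply/negP=> /mapP[y _ e]; move: h.
      by rewrite e => /or3P[] /mapP[z _] [] _ //; lia.
    + apply/allP=> x; rewrite !mem_cat /= => h; apply/negP=> /mapP[y _ e]; move: h.
      by rewrite e => /orP[] /mapP[].
    apply/allP=> x /mapP[p]; rewrite mem_filter mem_pairs => /andP[_ lt] ->.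
    by apply/negP=> /mapP[q _ [_ _]]; lia.
  - by move=> [u v] [u' v'] /= [-> ->].
  - by move=> [u v] [u' v'] /= [-> ->].
  - by move=> a b [->].
  by move=> a b [->].
have lt1 : n' < n'.+1 by []. have lt2 : n'.-1 < n'.+1 by lia.
have key l : (n' \in l) != (n'.-1 \in l) ->
    forall A : {set 'I_n'}, merge @^-1: A <> setof n'.+1 l.
  move=> /eqP ne A /setP eA; apply: ne.
  have := eA (Ordinal lt1); have := eA (Ordinal lt2); rewrite !inE /= => <- <-.
  by congr (_ \in A); apply: val_inj => /=; lia.
move=> xL; suff [s1 a1 nF ne] : [/\ sorted ltn x, all (ltn^~ n'.+1) x, setof n'.+1 x \notin F & (n' \in x) != (n'.-1 \in x)].
  by split=> //; apply: key.
move: xL; rewrite !mem_cat !inE -orbA => /or3P[/eqP->|/eqP->|/or4P[] /mapP[y]].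
- split=> //; [rewrite /=; lia | by apply: setof1_notin => //; lia | rewrite !inE; lia].
- split=> //; [rewrite /=; lia | by apply: setof1_notin => //; lia | rewrite !inE; lia].
- rewrite mem_iota => yn ->; have [nE1 nE2] := nEa y yn;
    split; [rewrite /=; lia | rewrite /=; lia | by [] | rewrite !inE; lia].
- rewrite mem_iota => yn ->; have [nE1 nE2] := nEa y yn;
    split; [rewrite /=; lia | rewrite /=; lia | by [] | rewrite !inE; lia].
- by case: y => u v; rewrite mem_filter mem_pairs /= => /andP[nT lt] ->;
    split; [rewrite /=; lia | rewrite /=; lia | exact: nT | rewrite !inE; lia].
by case: y => u v; rewrite mem_filter mem_pairs /= => /andP[nT lt] ->;
    split; [rewrite /=; lia | rewrite /=; lia | exact: nT | rewrite !inE; lia].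
Qed.

End Merge.

(** * A full star *)

Lemma merge_step n (F : {set {set 'I_n}}) s :
  2 < n -> upset F -> left_closed F -> setof n [:: 0] \notin F -> ~~ pairin F 0 n.-2 ->
  nomatch F s ->
  exists2 F' : {set {set 'I_n.-1}}, nomatch F' s &
    #|~: F'| + (2 * n.-1 +
      (npairs n.-2 (fun u v => ~~ triplein F u v n.-1) + npairs n.-2 (fun u v => ~~ triplein F u v n.-2)))
    <= #|~: F|.
Proof.
case: n F => [//|n'] F /= n'_gt1 upF lcF F1 nE nmF.
have h : 1 < n' by [].
exists [set A : {set 'I_n'} | merge h @^-1: A \in F]; first exact: nomatch_preim.
exact: merge_count.
Qed.

(** Products are generalised to variables here, which keeps the final comparison linear. *)
Lemma combine_bounds n X A K B1 B2 m m1 m2 y : X < A + 2 * K -> 2 * K <= B1 + B2 ->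
  A <= 2 * m -> B1 <= 2 * m1 -> B2 <= 2 * m2 -> 1 + n + m + (m1 + m2) <= y ->
  2 * (1 + n) + X < 2 * y.
Proof. lia. Qed.

Ltac if_lia := repeat (case: ifP => ?); lia.

Section Main.
Variables (n l c : nat) (F : {set {set 'I_n}}).
Hypotheses (n_eq : n = 2 * l + 3 * c) (l_gt0 : 0 < l) (s_ge3 : 3 <= l + c).
Hypotheses (nmF : nomatch F (l + c)) (upF : upset F) (lcF : left_closed F).
Hypothesis F1 : setof n [:: 0] \notin F.

Let y := #|~: F|.
Let missE := npairs n (fun u v => ~~ pairin F u v).
Let missT w := npairs w (fun u v => ~~ triplein F u v w).

Lemma count_total : 1 + n + missE + (missT n.-1 + missT n.-2) <= y.
Proof. by apply: count_direct => //; clear - n_eq l_gt0; lia. Qed.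

Lemma not_nested_bound j : j < l -> ~~ pairin F j (2 * l - 1 - j) ->
  2 * (1 + 2 * l + 3 * c) + (3 * c + 1 + j) * (4 * l + 3 * c - 2 - 3 * j) <= 2 * y.
Proof.
move=> jl nE; have := count_total; have := count_missE lcF nE.
rewrite (_ : n - _ = 3 * c + 1 + j); last by lia.
rewrite (_ : _ - 2 * j = 4 * l + 3 * c - 2 - 3 * j); last by lia.
by move=> h; have := h ltac:(lia) ltac:(lia); lia.
Qed.

(** Class [p] is c - 1 - p, c + p, 2c + p: nested pairs, completed by the last third in order. With
    this choice the number of missing triples forced by class [p] is least at [p = 0], as
    [star_arith1] and [region_arith] show. *)
Definition block_index z := if z < c then c - 1 - z else if z < 2 * c then z - c else z - 2 * c.

Lemma outside_pair : exists2 j, j < l + c & ~~ pairin F j (2 * (l + c) - 1 - j).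
Proof.
have [/forallP H|/forallPn[j jE]] := boolP [forall j : 'I_(l + c), pairin F j (2 * (l + c) - 1 - j)].
  have hn : 2 * (l + c) <= n by lia.
  by case: (nomatch_nested nmF upF hn) => i lti; apply: (H (Ordinal lti)).
by exists (val j); first exact: ltn_ord.
Qed.

(** The first [l] points are joined to everything, so the pairs [{i, n - 1 - i}] are in [F] and some
    triple of the middle 3c points is missing. The missing triples above it, together with the pairs
    above [{j, 2s - 1 - j}] where [j >= l], exceed the number for [famP]. *)
Lemma star_last : 0 < c -> pairin F (l - 1) n.-1 -> gt_min l c y.
Proof.
move=> c_gt0 El.
have El' a b : a < l -> a < b -> b < n -> pairin F a b by move=> *; apply: (pairin_mono lcF El); lia.
have [j jlt nE] := outside_pair.
have lj : l <= j by rewrite leqNgt; apply: contraNN nE => jl; apply: El'; lia.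
have [i lti miss] := nomatch_col upF
  (fun x => if x < l then x else if n - 1 - l < x then n - 1 - x else l + block_index (x - l)) nmF.
have [il|li] := ltnP i l.
  have /negP[] : setof n [:: i; n - 1 - i] \notin F.
    by apply: miss; apply/and3P; split=> //; if_lia.
  by apply: El'; lia.
pose p := i - l; have pc : p < c by rewrite /p; lia.
have nT : ~~ triplein F (l + c - 1 - p) (l + c + p) (l + 2 * c + p).
  by apply: miss; apply/and4P; split=> //; rewrite /block_index /p; if_lia.
have a1 : 2 * p + 2 <= l + 2 * c - 1 by rewrite /p; lia.
have a2 : j - l < c by lia.
have e1 : n - (2 * (l + c) - 1 - j) = l + c + 1 + (j - l) by clear - n_eq lj jlt; lia.
have e2 : n + (2 * (l + c) - 1 - j) - 1 - 2 * j = l + 5 * c - 2 - 3 * (j - l) by clear - n_eq lj jlt; lia.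
have e3 : n.-1 - (l + c + p) = l + 2 * c - 1 - p by clear - n_eq pc l_gt0; lia.
have e4 : n.-1 + (l + c + p) - 1 - 2 * (l + c - 1 - p) = l + 2 * c - 1 + 1 + 3 * p by clear - n_eq pc l_gt0; lia.
have e5 : n.-2 - (l + c + p) = l + 2 * c - 1 - 1 - p by clear - n_eq pc l_gt0; lia.
have e6 : n.-2 + (l + c + p) - 1 - 2 * (l + c - 1 - p) = l + 2 * c - 1 + 3 * p by clear - n_eq pc l_gt0; lia.
have b1 : j < 2 * (l + c) - 1 - j by clear - jlt; lia.
have b2 : 2 * (l + c) - 1 - j <= n by clear - n_eq; lia.
have h1 := count_missE lcF nE b1 b2.
have h2 : (n.-1 - (l + c + p)) * (n.-1 + (l + c + p) - 1 - 2 * (l + c - 1 - p)) <= 2 * missT n.-1.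
  by apply: (count_missT lcF nT); clear - n_eq pc l_gt0; lia.
have h3 : (n.-2 - (l + c + p)) * (n.-2 + (l + c + p) - 1 - 2 * (l + c - 1 - p)) <= 2 * missT n.-2.
  by apply: (count_missT lcF nT); clear - n_eq pc l_gt0; lia.
move: h1 h2 h3; rewrite e1 e2 e3 e4 e5 e6 => h1 h2 h3.
apply: Or31; rewrite /boundP.
have := count_total; rewrite {1}n_eq.
exact: combine_bounds (star_arith2 l_gt0 s_ge3 a2) (star_arith1 a1) h1 h2 h3.
Qed.

Lemma star_penult : 0 < c -> pairin F (l - 1) n.-2 -> ~~ pairin F 0 n.-1 -> gt_min l c y.
Proof.
move=> c_gt0 El nE0.
have El' a b : a < l -> a < b -> b < n.-1 -> pairin F a b.
  by move=> *; apply: (pairin_mono lcF El); lia.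
have [j jlt nE] := outside_pair.
have lj : l <= j.
  by rewrite leqNgt; apply: contraNN nE => jl; apply: El' => //; clear - n_eq jl jlt c_gt0; lia.
(* The pairs are now [{i, n - 2 - i}], which leaves 3c - 1 points in the middle; [n - 1] serves as
   third point of the last triple. *)
have [i lti miss] := nomatch_col upF
  (fun x => if x < l then x else if x == n - 1 then l + (c - 1)
            else if n - 2 - l < x then n - 2 - x else l + block_index (x - l)) nmF.
have [il|li] := ltnP i l.
  have /negP[] : setof n [:: i; n - 2 - i] \notin F.
    by apply: miss; apply/and3P; split=> //; if_lia.
  by apply: El'; clear - n_eq il c_gt0; lia.
pose p := i - l; have pc : p < c by rewrite /p; clear - li lti; lia.
have hT : (l + c) * (l + 5 * c - 3) <= 2 * (missT n.-1 + missT n.-2).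
  have [pc1|pc1] := ltnP p (c - 1).
    have nT : ~~ triplein F (l + c - 1 - p) (l + c + p) (l + 2 * c + p).
      by apply: miss; apply/and4P; split=> //; rewrite /block_index /p; move: pc1; rewrite /p => pc1; if_lia.
    have a1 : 2 * p + 2 <= l + 2 * c - 1 by clear - pc l_gt0; lia.
    have a2 : l + 2 * c - 1 + 1 = l + c + c by clear - l_gt0; lia.
    have e3 : n.-1 - (l + c + p) = l + 2 * c - 1 - p by clear - n_eq pc l_gt0; lia.
    have e4 : n.-1 + (l + c + p) - 1 - 2 * (l + c - 1 - p) = l + 2 * c - 1 + 1 + 3 * p by clear - n_eq pc l_gt0; lia.
    have e5 : n.-2 - (l + c + p) = l + 2 * c - 1 - 1 - p by clear - n_eq pc l_gt0; lia.
    have e6 : n.-2 + (l + c + p) - 1 - 2 * (l + c - 1 - p) = l + 2 * c - 1 + 3 * p by clear - n_eq pc l_gt0; lia.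
    have h2 : (n.-1 - (l + c + p)) * (n.-1 + (l + c + p) - 1 - 2 * (l + c - 1 - p)) <= 2 * missT n.-1.
      by apply: (count_missT lcF nT); clear - n_eq pc l_gt0; lia.
    have h3 : (n.-2 - (l + c + p)) * (n.-2 + (l + c + p) - 1 - 2 * (l + c - 1 - p)) <= 2 * missT n.-2.
      by apply: (count_missT lcF nT); clear - n_eq pc1 l_gt0; lia.
    move: h2 h3; rewrite e3 e4 e5 e6 => h2 h3; rewrite [2 * (_ + _)]mulnDr.
    apply: leq_trans (leq_trans (star_arith1 a1) (leq_add h2 h3)).
    rewrite (_ : l + 5 * c - 3 = l + c + 4 * c - 3); last by clear; lia.
    by apply: star_arith4; clear - l_gt0; lia.
  have nT : ~~ triplein F l (l + 2 * c - 1) n.-1.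
    by apply: miss; apply/and4P; split=> //; rewrite /block_index; move: pc1; rewrite /p => pc1; if_lia.
  rewrite [2 * (_ + _)]mulnDr; apply: leq_trans (leq_addr _ _).
  have <- : n.-1 - (l + 2 * c - 1) = l + c by clear - n_eq c_gt0; lia.
  have <- : n.-1 + (l + 2 * c - 1) - 1 - 2 * l = l + 5 * c - 3 by clear - n_eq c_gt0; lia.
  by apply: (count_missT lcF nT); clear - n_eq c_gt0; lia.
(* All pairs through [n - 1] are missing; the region above the missing pair is counted among the
   first n - 1 points only. *)
have hE : 2 * n.-1 + (l + c + (j - l)) * (l + 5 * c - 3 - 3 * (j - l)) <= 2 * missE.
  rewrite /missE; have [n' en] : exists n', n = n'.+1 by exists n.-1; clear - n_eq l_gt0; lia.
  rewrite {2}en npairsS mulnDr addnC leq_add //; last first.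
    rewrite leq_pmul2l // (eq_in_count (a2 := predT)) ?count_predT ?size_iota ?en //= => u.
    rewrite mem_iota => /= un; apply: contraNN nE0 => h.
    by apply: (pairin_mono lcF h); clear - un en; lia.
  have <- : n' - (2 * (l + c) - 1 - j) = l + c + (j - l) by clear - n_eq en lj jlt; lia.
  have <- : n' + (2 * (l + c) - 1 - j) - 1 - 2 * j = l + 5 * c - 3 - 3 * (j - l) by clear - n_eq en lj jlt; lia.
  apply: npairs_region_bound => [||u v ju kv lt]; try by clear - n_eq en c_gt0 jlt; lia.
  by apply: contraNN nE => h; apply: (pairin_mono lcF h); clear - ju kv lt en jlt; lia.
have a3 : j - l < c by clear - lj jlt l_gt0; lia.
have {}a3 := star_arith3 l_gt0 s_ge3 a3.
have e7 : 2 * l + 3 * c - 1 = n.-1 by clear - n_eq; lia.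
have e8 : 1 + 2 * l + 3 * c = 1 + n by clear - n_eq; lia.
apply: Or31; rewrite /boundP e8; rewrite {}e7 in a3.
have := count_total; move: a3 hT hE; clear.
move: (_ * (l + 5 * c - 3)) => A; move: (_ * (l + 5 * c - 3 - _)) => B.
by rewrite -addnA => *; lia.
Qed.

End Main.

(** * Deleting a pair of points that belongs to the family *)

Section Remove.
Variables (n l c : nat) (F : {set {set 'I_n}}).
Hypotheses (n_eq : n = 2 * l + 3 * c) (l_gt1 : 1 < l) (s_ge3 : 3 <= l + c).
Hypotheses (nmF : nomatch F (l + c)) (upF : upset F) (lcF : left_closed F).
Hypothesis F1 : setof n [:: 0] \notin F.
Hypothesis IH : forall n' l' c' (F' : {set {set 'I_n'}}), n' < n -> n' = 2 * l' + 3 * c' ->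
  0 < l' -> nomatch F' (l' + c') -> ge_min l' c' #|~: F'|.

(** The listed sets meet [{a, b}] and so are not images under [f]. Their number l + 3c + 3 is one
    more than the growth of the number missing from [famP] between [l - 1] and [l]. *)
Lemma remove_gt_min (f : 'I_(n - 2) -> 'I_n) a b (L : seq (seq nat)) :
  injective f -> (forall x, val (f x) <> a /\ val (f x) <> b) -> a < n -> b < n -> pairin F a b ->
  uniq L -> l + 3 * c + 3 <= size L ->
  (forall k, k \in L -> [/\ sorted ltn k, all (ltn^~ n) k, setof n k \notin F &
                         (a \in k) || (b \in k)]) ->
  gt_min l c #|~: F|.
Proof.
move=> fI fab ltan ltbn Eab uL sL HL.
have nm' := nomatch_remove upF fI Eab fab.
have l_eq : l.-1.+1 = l by lia.
rewrite -l_eq; apply: (@gt_min_remove _ _ _ #|~: [set A : {set 'I_(n - 2)} | f @: A \in F]|).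
- by lia.
- by apply: IH; [lia | lia | lia | apply: nm'; rewrite -addSn l_eq].
apply: leq_trans (_ : _ <= #|~: [set A : {set 'I_(n - 2)} | f @: A \in F]| + size L) _.
  by rewrite leq_add2l; lia.
apply: count_missing_map (imset_inj fI) _ uL _ => [A|k]; first by rewrite inE.
move=> /HL[s1 a1 nF ab]; split=> // A /setP eA.
case/orP: ab => ak.
  have := eA (Ordinal ltan); rewrite !inE ak => /imsetP[x _ ex].
  by have [] := fab x; rewrite -ex.
have := eA (Ordinal ltbn); rewrite !inE ak => /imsetP[x _ ex].
by have [] := fab x; rewrite -ex.
Qed.

Lemma degree_exists v : 0 < v -> v < n -> l <= v -> pairin F 0 v -> ~~ pairin F (l - 1) v ->
  exists d, [/\ 0 < d, d < l & forall a, d <= a -> a < v -> ~~ pairin F a v].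
Proof.
move=> v_gt0 vn lv E0 El.
have ex : exists d, ~~ pairin F d v by exists (l - 1).
case: (ex_minnP ex) => d nEd mind; exists d; split.
- by case: d nEd {mind} => //; rewrite E0.
- by have := mind _ El; lia.
by move=> a da av; apply: contraNN nEd => h; apply: (pairin_mono lcF h); lia.
Qed.

Lemma remove_first_last : pairin F 0 n.-1 -> ~~ pairin F (l - 1) n.-1 ->
  ~~ triplein F (n - 3) (n - 2) (n - 1) -> gt_min l c #|~: F|.
Proof.
move=> E0 El nT.
have n_gt5 : 5 < n by lia.
have [d [d_gt0 dl nEd]] := @degree_exists n.-1 ltac:(lia) ltac:(lia) ltac:(lia) E0 El.
have flt (x : 'I_(n - 2)) : x.+1 < n by have := ltn_ord x; lia.
(* As [d <= l - 1], there are 3 + (n - 1 - d) >= l + 3c + 3 entries; for [d = l - 1] the last triple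
   is the decisive one. *)
pose L := [:: [:: 0]; [:: n.-1]; [:: n - 3; n - 2; n - 1]]
  ++ [seq [:: a; n.-1] | a <- iota d (n.-1 - d)].
apply: (@remove_gt_min (fun x => Ordinal (flt x)) 0 n.-1 L) => //.
- by move=> x x' [] xx'; apply: val_inj.
- by move=> x /=; split=> //; have := ltn_ord x; lia.
- by lia.
- by lia.
- rewrite /L cat_uniq map_inj_uniq ?iota_uniq; last by move=> a b [->].
  rewrite andbT /= -all_predC !inE; apply/andP; split.
    by rewrite !eqseq_cons !andbF !andbT; lia.
  by apply/allP=> x /mapP[a _ ->]; rewrite /= !inE !eqseq_cons !andbF.
- by rewrite /L size_cat size_map size_iota /=; lia.
move=> k; rewrite /L mem_cat !inE -!orbA => /or4P[/eqP->|/eqP->|/eqP->|/mapP[a]].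
- by split; rewrite //= ?inE //; lia.
- split=> //; [by rewrite /=; clear - n_gt5; lia | | by rewrite !inE eqxx orbT].
  by apply: setof1_notin => //; clear - n_gt5; lia.
- split; [by rewrite /=; clear - n_gt5; lia | by rewrite /=; clear - n_gt5; lia | exact: nT |].
  by rewrite !inE (_ : n.-1 = n - 1) ?eqxx ?orbT //; clear; lia.
rewrite mem_iota => lt ->.
split; [by rewrite /=; clear - lt; lia | by rewrite /=; clear - lt; lia | | by rewrite !inE eqxx ?orbT].
by apply: nEd; clear - lt; lia.
Qed.

Lemma remove_first_penult : pairin F 0 n.-2 -> ~~ pairin F (l - 1) n.-2 -> ~~ pairin F 0 n.-1 ->
  gt_min l c #|~: F|.
Proof.
move=> E0 El nE0.
have n_gt5 : 5 < n by lia.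
have [d [d_gt0 dl nEd]] := @degree_exists n.-2 ltac:(lia) ltac:(lia) ltac:(lia) E0 El.
have nEl a : a < n.-1 -> ~~ pairin F a n.-1.
  by move=> lt; apply: contraNN nE0 => h; apply: (pairin_mono lcF h); lia.
(* The embedding skips 0 and [n - 2], so the last index goes to [n - 1]. *)
have flt (x : 'I_(n - 2)) : (if x.+1 == n.-2 then n.-1 else x.+1) < n.
  by have := ltn_ord x; case: ifP; lia.
pose L := [:: [:: 0]; [:: n.-2]; [:: n.-2; n.-1]; [:: 0; n.-1]]
  ++ [seq [:: a; n.-2] | a <- iota d (n.-2 - d)].
apply: (@remove_gt_min (fun x => Ordinal (flt x)) 0 n.-2 L) => //.
- move=> x x' [] xx'; apply: val_inj; move: xx'; have := ltn_ord x; have := ltn_ord x'.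
  by move=> /=; case: ifP; case: ifP; lia.
- by move=> x /=; have := ltn_ord x; case: ifP; lia.
- by lia.
- by lia.
- rewrite /L cat_uniq map_inj_uniq ?iota_uniq; last by move=> a b [->].
  rewrite andbT /= -all_predC !inE; apply/andP; split.
    by rewrite !eqseq_cons !andbF !andbT; lia.
  apply/allP=> x /mapP[a]; rewrite mem_iota => ad ->; rewrite /= !inE !eqseq_cons !andbF !andbT.
  by lia.
- by rewrite /L size_cat size_map size_iota /=; lia.
move=> k; rewrite /L mem_cat !inE -!orbA => /or4P[/eqP->|/eqP->|/eqP->|/orP[/eqP->|/mapP[a]]].
- by split; rewrite //= ?inE //; lia.
- split=> //; [by rewrite /=; clear - n_gt5; lia | | by rewrite !inE eqxx orbT].
  by apply: setof1_notin => //; clear - n_gt5; lia.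
- split; [by rewrite /=; clear - n_gt5; lia | by rewrite /=; clear - n_gt5; lia | | by rewrite !inE eqxx ?orbT].
  by apply: nEl; clear - n_gt5; lia.
- split; [by rewrite /=; clear - n_gt5; lia | by rewrite /=; clear - n_gt5; lia | | by rewrite !inE eqxx ?orbT].
  by apply: nEl; clear - n_gt5; lia.
rewrite mem_iota => lt ->.
split; [by rewrite /=; clear - lt; lia | by rewrite /=; clear - lt; lia | | by rewrite !inE eqxx ?orbT].
by apply: nEd; clear - lt; lia.
Qed.

End Remove.

(** * Merging the last two points *)

Lemma mul2_bin2 m : 2 * 'C(m, 2) = m * (m - 1).
Proof. by elim: m => // m IH; rewrite binS bin1 mulnDr IH; nia. Qed.

Lemma region_arith c p : p < c -> (2 * c - 1) * (2 * c - 2) <= (2 * c - 2 - p) * (2 * c - 1 + 3 * p).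
Proof.
move=> pc; have [r ->] : exists r, c = p + 1 + r by exists (c - p - 1); lia.
rewrite (_ : _ - 2 - p = p + 2 * r); last by lia.
rewrite (_ : _ - 1 + 3 * p = 5 * p + 2 * r + 1); last by lia.
rewrite (_ : _ - 1 = 2 * p + 2 * r + 1); last by lia.
rewrite (_ : _ - 2 = 2 * p + 2 * r); last by lia.
case: (posnP r) => [->|r0]; [case: p {pc} => [|p] | ]; nia.
Qed.

Lemma region_arith_strict c p : 2 < c -> 0 < p -> p < c ->
  (2 * c - 1) * (2 * c - 2) < (2 * c - 2 - p) * (2 * c - 1 + 3 * p).
Proof.
move=> c2 p0 pc; have [r er] : exists r, c = p + 1 + r by exists (c - p - 1); lia.
rewrite {}er in c2 *.
rewrite (_ : _ - 2 - p = p + 2 * r); last by lia.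
rewrite (_ : _ - 1 + 3 * p = 5 * p + 2 * r + 1); last by lia.
rewrite (_ : _ - 1 = 2 * p + 2 * r + 1); last by lia.
rewrite (_ : _ - 2 = 2 * p + 2 * r); last by lia.
nia.
Qed.

Section MergeCase.
Variables (n l c : nat) (F : {set {set 'I_n}}).
Hypotheses (n_eq : n = 2 * l + 3 * c) (l_gt0 : 0 < l).
Hypotheses (nmF : nomatch F (l + c)) (upF : upset F) (lcF : left_closed F).
Hypothesis nested : forall i, i < l -> pairin F i (2 * l - 1 - i).

Lemma residual_missing (h : nat -> nat) : exists2 p, p < c &
  forall u v w, u < v -> v < w -> w < 3 * c -> h u = p -> h v = p -> h w = p ->
    ~~ triplein F (2 * l + u) (2 * l + v) (2 * l + w).
Proof.
have [i lti miss] := nomatch_col upF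
  (fun x => if x < l then x else if x < 2 * l then 2 * l - 1 - x else l + h (x - 2 * l)) nmF.
have [il|li] := ltnP i l.
  have /negP[] : setof n [:: i; 2 * l - 1 - i] \notin F.
    by apply: miss; apply/and3P; split=> //; if_lia.
  exact: nested.
have hR x : h x = i - l ->
    (if 2 * l + x < l then 2 * l + x else if 2 * l + x < 2 * l then 2 * l - 1 - (2 * l + x)
     else l + h (2 * l + x - 2 * l)) == i.
  by rewrite addKn => ->; if_lia.
exists (i - l) => [|u v w uv vw wc hu hv hw]; first by lia.
by apply: miss; apply/and4P; split=> //; apply: hR.
Qed.

Lemma last_triple_missing : 0 < c -> ~~ triplein F (n - 3) (n - 2) (n - 1).
Proof.
move=> c_gt0; have [p pc miss] := residual_missing (fun x => block_index c x).
have nT : ~~ triplein F (2 * l + (c - 1 - p)) (2 * l + (c + p)) (2 * l + (2 * c + p)).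
  by apply: miss; rewrite /block_index; if_lia.
by apply: contraNN nT => h; apply: (triplein_mono lcF h); lia.
Qed.

Let swp a b x : nat := if x == a then b else if x == b then a else x.

Let swpK a b : involutive (swp a b).
Proof.
move=> x; rewrite /swp; case: (x =P a) => [->|/eqP xa].
  by rewrite eqxx; case: (b =P a).
by case: (x =P b) => [->|/eqP xb]; rewrite ?eqxx // (negPf xa) (negPf xb).
Qed.

Let swp_lt a b x : a < c -> b < c -> x < c -> swp a b x < c.
Proof. by rewrite /swp => *; if_lia. Qed.

Let missH w := npairs n.-2 (fun u v => (2 * l <= u) && ~~ triplein F u v w).

(* The c triples are completed by the last c points, block i receiving n-1 and block i'
   receiving n-2. *)
Lemma pairing_missing i i' (h : nat -> nat) : i < c -> i' < c -> i != i' ->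
  exists2 p, p < c & forall u v, u < v -> v < 2 * c -> h u = p -> h v = p ->
    (p != i -> ~~ triplein F (2 * l + u) (2 * l + v) n.-2) /\ ~~ triplein F (2 * l + u) (2 * l + v) n.-1.
Proof.
move=> ic i'c ii'.
(* Two transpositions give a permutation [rho] of the classes with [rho (c - 1) = i] and
   [rho (c - 2) = i']; the point 2l + 2c + x goes to class [rho x]. A class other than [i] thus has
   its last point at most [n - 2]. *)
pose q := swp i (c - 1) i'.
pose rho x := swp i (c - 1) (swp (c - 2) q x).
have rhoK t : t < c -> exists2 x, x < c & rho x = t.
  move=> tc; exists (swp (c - 2) q (swp i (c - 1) t)); last by rewrite /rho !swpK.
  by rewrite !swp_lt //; lia.
have q1 : q != c - 1 by rewrite /q /swp; if_lia.
have rho1 : rho (c - 1) = i.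
  rewrite /rho [swp (c - 2) q _](_ : _ = c - 1); first by rewrite /swp; if_lia.
  by rewrite /swp; if_lia.
have [p pc miss] := residual_missing (fun x => if x < 2 * c then h x else rho (x - 2 * c)).
exists p => // u v uv vc hu hv.
have [t tc rt] := rhoK p pc.
have nT : ~~ triplein F (2 * l + u) (2 * l + v) (2 * l + (2 * c + t)).
  apply: (miss _ _ _ uv); [lia | lia | rewrite ifT //; lia | by rewrite ifT | ].
  by rewrite ifF ?addKn //; lia.
split=> [pi|]; apply: contraNN nT => h'; apply: (triplein_mono lcF h'); try lia.
have : t != c - 1 by apply: contraNneq pi => tc1; rewrite -rt tc1 rho1.
lia.
Qed.

Lemma missH_region p w : p < c -> n.-2 <= w -> w < n ->
  ~~ triplein F (2 * l + (c - 1 - p)) (2 * l + (c + p)) n.-2 ->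
  (2 * c - 2 - p) * (2 * c - 1 + 3 * p) <= 2 * missH w.
Proof.
move=> pc w1 w2 nT.
have <- : n.-2 - (2 * l + (c + p)) = 2 * c - 2 - p by clear - n_eq pc; lia.
have <- : n.-2 + (2 * l + (c + p)) - 1 - 2 * (2 * l + (c - 1 - p)) = 2 * c - 1 + 3 * p.
  by clear - n_eq pc; lia.
apply: npairs_region_bound => [||u v u1 v1 lt]; try by clear - n_eq pc; lia.
have -> : 2 * l <= u by clear - u1; lia.
by apply: contraNN nT => h; apply: (triplein_mono lcF h); clear - u1 v1 lt n_eq w1 w2 pc l_gt0; lia.
Qed.

(* Reflection (u, v) -> (2c-1-v, 2c-1-u) maps the pairs whose triple with n-1 is present
   to pairs whose triple with n-2 is missing. *)
Lemma missH_complement : 1 < c ->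
  (forall p, p < c -> triplein F (2 * l + (c - 1 - p)) (2 * l + (c + p)) n.-2) ->
  'C(3 * c - 2, 2) <= missH n.-1 + missH n.-2.
Proof.
move=> c_gt1 HT.
pose ix x := if x < c then c - 1 - x else x - c.
have ixE p : p < c -> ix (c - 1 - p) = p /\ ix (c + p) = p.
  by move=> pc; rewrite /ix; split; if_lia.
have ix_lt x : x < 2 * c -> ix x < c by move=> xc; rewrite /ix; if_lia.
have ixC x : x < 2 * c -> ix (2 * c - 1 - x) = ix x by move=> xc; rewrite /ix; if_lia.
have ixI x x' : x < 2 * c -> x' < 2 * c -> ix x = ix x' -> x = x' \/ x' = 2 * c - 1 - x.
  by move=> xc xc'; rewrite /ix; if_lia.
(* Class [p] receives [n - 1]. Any other nested pair forms a member with [n - 2] by [HT], so class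
   [p] itself is the missing one. *)
have mid p : p < c -> ~~ triplein F (2 * l + (c - 1 - p)) (2 * l + (c + p)) n.-1.
  move=> pc.
  have [p' p'c pp'] : exists2 p', p' < c & p != p' by case: (posnP p) => p0; [exists 1 | exists 0]; lia.
  have [k kc miss] := pairing_missing ix pc p'c pp'.
  have [e1 e2] := ixE k kc.
  have lt1 : c - 1 - k < c + k by lia.
  have lt2 : c + k < 2 * c by lia.
  have [nT2 nT1] := miss _ _ lt1 lt2 e1 e2.
  have [kp|kp] := eqVneq k p; first by rewrite -kp.
  by have := nT2 kp; rewrite HT.
have low u v : u < v -> u + v <= 2 * c - 2 -> triplein F (2 * l + u) (2 * l + v) n.-1 ->
    ~~ triplein F (2 * l + (2 * c - 1 - v)) (2 * l + (2 * c - 1 - u)) n.-2.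
  move=> uv uvc Tuv.
  have uc : u < 2 * c by lia.
  have vc : v < 2 * c by lia.
  have ne : ix u != ix v by apply/eqP => /(ixI _ _ uc vc); lia.
  (* The nested pairs of [u] and [v] are regrouped into [{u, v}], which receives [n - 1], and the
     pair of their reflections. The first class is present by [Tuv], the untouched ones by [HT];
     only the reflected pair can be missing. *)
  pose h x := if (x == u) || (x == v) then ix u
    else if (x == 2 * c - 1 - u) || (x == 2 * c - 1 - v) then ix v else ix x.
  have [k kc miss] := pairing_missing h (ix_lt u uc) (ix_lt v vc) ne.
  have [ku|ku] := eqVneq k (ix u).
    have hu : h u = k by rewrite ku /h eqxx.
    have hv : h v = k by rewrite ku /h eqxx orbT.
    by have [_] := miss u v uv vc hu hv; rewrite Tuv.
  have [kv|kv] := eqVneq k (ix v).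
    have lt1 : 2 * c - 1 - v < 2 * c - 1 - u by lia.
    have lt2 : 2 * c - 1 - u < 2 * c by lia.
    have h1 : h (2 * c - 1 - v) = k by rewrite kv /h ifF ?eqxx ?orbT //; lia.
    have h2 : h (2 * c - 1 - u) = k by rewrite kv /h ifF ?eqxx //; lia.
    have [+ _] := miss _ _ lt1 lt2 h1 h2.
    by apply; rewrite kv eq_sym.
  have [e1 e2] := ixE k kc.
  have hk x : x < 2 * c -> ix x = k -> h x = k.
    move=> xc ek; rewrite /h; case: ifP => [/orP[]/eqP xe|_].
    - by rewrite -ek xe.
    - by move: kv; rewrite -ek xe eqxx.
    case: ifP => // /orP[]/eqP xe.
      by move: ku; rewrite -ek xe ixC // eqxx.
    by rewrite -ek xe ixC.
  have lt1 : c - 1 - k < c + k by lia.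
  have lt2 : c + k < 2 * c by lia.
  have [] := miss _ _ lt1 lt2 (hk _ _ e1) (hk _ lt2 e2); first by lia.
  by move=> /(_ ku); rewrite HT.
rewrite -(npairs_predC _ (fun u v => ~~ triplein F (2 * l + u) (2 * l + v) n.-1)).
apply: leq_add.
  apply: (npairs_inj (f := fun p => (2 * l + p.1, 2 * l + p.2))) => [u v lt nT /=|].
    by rewrite leq_addr nT; split=> //; lia.
  by move=> [u v] [u' v'] _ _ /= [] /addnI-> /addnI->.
have lowP u v : u < v -> v < 3 * c - 2 -> triplein F (2 * l + u) (2 * l + v) n.-1 -> u + v <= 2 * c - 2.
  move=> uv vc Tuv; rewrite leqNgt; apply/negP=> gt.
  have [cu|uc] := leqP (c - 1) u.
    have := mid 0 ltac:(lia); rewrite (triplein_mono lcF Tuv) //; lia.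
  have := mid (c - 1 - u) ltac:(lia); rewrite (triplein_mono lcF Tuv) //; lia.
apply: (npairs_inj (f := fun p => (2 * l + (2 * c - 1 - p.2), 2 * l + (2 * c - 1 - p.1)))).
  move=> u v /andP[uv vc] /=; rewrite negbK => Tuv; have uvc := lowP _ _ uv vc Tuv.
  by rewrite leq_addr low //; split=> //; lia.
move=> [u v] [u' v']; rewrite !inE /= !negbK => /andP[/andP[uv vc] Tuv] /andP[/andP[uv' vc'] Tuv'].
have := lowP _ _ uv vc Tuv; have := lowP _ _ uv' vc' Tuv'.
by move=> ? ? [] /addnI e1 /addnI e2; congr (_, _); lia.
Qed.

(** The bound is twice C(2c - 1, 2), the number of triples missing from [famQ] with exactly one of
    the last two points. Either a missing nested pair forces a large region for both points, or the
    reflection argument gives C(3c - 2, 2), which is at least as large for [c >= 2]. *)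
Lemma missH_bound : 1 < c -> (2 * c - 1) * (2 * c - 2) <= missH n.-1 + missH n.-2.
Proof.
move=> c_gt1.
have [/forallP HT|/forallPn[p nT]] :=
  boolP [forall p : 'I_c, triplein F (2 * l + (c - 1 - p)) (2 * l + (c + p)) n.-2].
  apply: leq_trans (missH_complement c_gt1 (fun p pc => HT (Ordinal pc))).
  by rewrite -(leq_pmul2l (m := 2)) // mul2_bin2; clear - c_gt1; nia.
have pc := ltn_ord p.
have := missH_region pc _ _ nT => /(_ n.-1) h1; have := missH_region pc _ _ nT => /(_ n.-2) h2.
have {}h1 := h1 ltac:(clear; lia) ltac:(clear - n_eq c_gt1; lia).
have {}h2 := h2 ltac:(clear; lia) ltac:(clear - n_eq c_gt1; lia).
have a := region_arith pc; clear - h1 h2 a; lia.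
Qed.

(** [famQ] omits the triples on the points from 2l + c - 1 on; the triple in the hypothesis is the
    topmost one of [famQ] through [n - 1] avoiding [n - 2]. If the region argument gives equality,
    this triple lies outside the region. *)
Lemma missH_bound_strict : 2 < c -> ~~ triplein F (2 * l + (c - 2)) (n - 3) n.-1 ->
  (2 * c - 1) * (2 * c - 2) < missH n.-1 + missH n.-2.
Proof.
move=> c_gt2 nT'; have c_gt1 : 1 < c by lia.
have [/forallP HT|/forallPn[p nT]] :=
  boolP [forall p : 'I_c, triplein F (2 * l + (c - 1 - p)) (2 * l + (c + p)) n.-2].
  apply: leq_trans (missH_complement c_gt1 (fun p pc => HT (Ordinal pc))).
  by rewrite -(leq_pmul2l (m := 2)) // mul2_bin2; clear - c_gt2; nia.
have pc := ltn_ord p.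
have h2 : (2 * c - 2 - p) * (2 * c - 1 + 3 * p) <= 2 * missH n.-2.
  by apply: missH_region nT => //; clear - n_eq c_gt1; lia.
have h1 : (2 * c - 2 - p) * (2 * c - 1 + 3 * p) <= 2 * missH n.-1.
  by apply: missH_region nT => //; clear - n_eq c_gt1; lia.
have [p0|p_gt0] := posnP p; last first.
  have a := region_arith_strict c_gt2 p_gt0 pc; clear - h1 h2 a; lia.
move: nT h1 h2; rewrite p0 subn0 addn0 muln0 addn0 => nT _ h2.
have {}h1 : (2 * c - 2) * (2 * c - 1) < 2 * missH n.-1.
  have <- : n.-2 - (2 * l + c) = 2 * c - 2 by clear - n_eq; lia.
  have <- : n.-2 + (2 * l + c) - 1 - 2 * (2 * l + (c - 1)) = 2 * c - 1 by clear - n_eq c_gt1; lia.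
  rewrite -npairs_region_eq; [|by clear - c_gt1; lia | by clear - n_eq c_gt1; lia].
  rewrite ltn_pmul2l //; apply: (@ltn_npairs _ _ _ (2 * l + (c - 2)) (n - 3)).
  - move=> u v lt /andP[u1 v1].
    have -> : 2 * l <= u by clear - u1; lia.
    by apply: contraNN nT => h; apply: (triplein_mono lcF h); clear - u1 v1 lt n_eq c_gt1 l_gt0; lia.
  - by clear - n_eq c_gt2; lia.
  - by rewrite leq_addr nT'.
  by clear - c_gt2; lia.
rewrite mulnC; clear - h1 h2; lia.
Qed.

End MergeCase.

Lemma setofP n (A : {set 'I_n}) :
  exists s, [/\ sorted ltn s, all (ltn^~ n) s, size s = #|A| & A = setof n s].
Proof.
exists [seq val x | x <- enum A]; split.
- have /(map_subseq val) sub : subseq (enum A) (enum 'I_n).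
    by rewrite {1}/enum_mem enumT; apply: filter_subseq.
  by apply: (subseq_sorted ltn_trans sub); rewrite val_enum_ord iota_ltn_sorted.
- by apply/allP=> _ /mapP[x _ ->]; apply: ltn_ord.
- by rewrite size_map cardE.
by apply/setP=> x; rewrite inE (mem_map val_inj) mem_enum.
Qed.

(** * Containment in the four families *)

Section Containment.
Variables (n : nat) (F : {set {set 'I_n}}).
Hypotheses (upF : upset F) (lcF : left_closed F) (F1 : setof n [:: 0] \notin F).

Lemma member_cases (A : {set 'I_n}) : A \in F ->
  (exists a b, [/\ a < b, b < n, A = setof n [:: a; b], #|A| = 2 & pairin F a b]) \/
  (exists a b w r, [/\ a < b, b < w, w < n, A = setof n (a :: b :: w :: r) & size r + 3 = #|A|] /\
     sorted ltn (w :: r) && all (ltn^~ n) r).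
Proof.
move=> AF; have [s [so al sz eA]] := setofP A; rewrite -sz; move: AF; rewrite eA.
case: s so al {eA sz} => [|a [|b [|w r]]] /=.
- by move=> _ _ AF; rewrite (negPf (setof0_notin upF F1)) in AF.
- by move=> _ /andP[an _] AF; rewrite (negPf (setof1_notin lcF F1 an)) in AF.
- by move=> /andP[ab _] /and3P[_ bn _] AF; left; exists a, b.
move=> /and3P[ab bw so] /and4P[_ _ wn al] AF; right; exists a, b, w, r.
by rewrite addn3 so al.
Qed.

Lemma triple_of (A : {set 'I_n}) : A \in F -> #|A| = 3 ->
  exists a b w, [/\ a < b, b < w, w < n, A = setof n [:: a; b; w] & triplein F a b w].
Proof.
move=> AF cA; have [[a [b [_ _ _ c2 _]]]|] := member_cases AF; first by rewrite cA in c2.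
move=> [a [b [w [r [[ab bw wn eA]]]]]]; rewrite cA => sr _.
have r0 : r = [::] by case: r sr {eA} => //= *; lia.
by exists a, b, w; split=> //; rewrite eA r0 // in AF *.
Qed.

Lemma setof2_sub_itv a b m : a < b -> b < m -> setof n [:: a; b] \subset itv n 1 m.
Proof. by move=> ab bm; apply/subsetP=> x; rewrite !inE => /orP[]/eqP->; lia. Qed.

Lemma itv_full : itv n 1 n = setT.
Proof. by apply/setP=> x; rewrite !inE /= ltn_ord. Qed.

(** Here and in the next three lemmas left-closedness reduces containment to the lowest sets outside
    the family, in 0-based numbering: for [famP] this is the pair [{l - 1, l}]. *)
Lemma sub_famP s l : 0 < l -> l < n -> ~~ pairin F (l - 1) l -> F \subset famP n s l.
Proof.
move=> l_gt0 ln nE; apply/subsetP=> A AF; rewrite inE.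
have [[a [b [ab bn eA cA Eab]]]|[a [b [w [r [[_ _ _ _ <-] _]]]]]] := member_cases AF; last by lia.
rewrite cA -[3]/(2 + 1) leq_add2l.
have al : a < l - 1.
  by rewrite ltnNge; apply: contraNN nE => la; apply: (pairin_mono lcF Eab); lia.
have an : a < n by lia.
by apply/card_gt0P; exists (Ordinal an); rewrite eA !inE eqxx /=; lia.
Qed.

Lemma sub_famP' s l : 0 < l -> 2 * l - 1 < n -> ~~ pairin F 0 (2 * l - 1) -> F \subset famP' n s l.
Proof.
move=> l_gt0 ln nE; apply/subsetP=> A AF; rewrite !inE itv_full subsetT.
have [[a [b [ab bn eA cA Eab]]]|[a [b [w [r [[_ _ _ _ <-] _]]]]]] := member_cases AF; last by lia.
rewrite cA /= andbT eA setof2_sub_itv // ltnNge.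
by apply: contraNN nE => lb; apply: (pairin_mono lcF Eab); lia.
Qed.

Lemma sub_famQ s l : 0 < s + l - 1 -> s + l + 1 < n -> ~~ pairin F 0 (s + l - 1) ->
  ~~ triplein F (s + l - 1) (s + l) (s + l + 1) -> F \subset famQ n s l.
Proof.
move=> a_gt0 an nE nT; apply/subsetP=> A AF; rewrite !inE itv_full subsetT /=.
apply/andP; split.
  apply/negP=> /andP[sA /eqP cA].
  have [a [b [w [ab bw wn eA Tabw]]]] := triple_of AF cA.
  have an' : a < n by lia.
  have := subsetP sA (Ordinal an'); rewrite eA !inE eqxx /= => /(_ isT) la.
  by move/negP: nT; apply; apply: (triplein_mono lcF Tabw); lia.
have [[a [b [ab bn eA cA Eab]]]|[a [b [w [r [[_ _ _ _ <-] _]]]]]] := member_cases AF; last by lia.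
rewrite cA /= andbT eA setof2_sub_itv // ltnNge.
by apply: contraNN nE => lb; apply: (pairin_mono lcF Eab); lia.
Qed.

Lemma sub_famW s l : 0 < 2 * s - 1 -> n = 2 * s + 1 -> ~~ pairin F 0 n.-2 ->
  ~~ triplein F 0 n.-2 n.-1 -> F \subset famW n s l.
Proof.
move=> s_gt0 n_eq nE nT; apply/subsetP=> A AF; rewrite inE.
suff [a [b [ab bs sA]]] : exists a b, [/\ a < b, b < 2 * s - 1 & setof n [:: a; b] \subset A].
  have an : a < n by lia.
  have bn : b < n by lia.
  rewrite (leq_trans _ (subset_leq_card (_ : [set Ordinal an; Ordinal bn] \subset _))) //.
    by rewrite cards2 -val_eqE /= neq_ltn ab.
  apply/subsetP=> x; rewrite !inE => /orP[]/eqP->; apply/andP; split=> /=; try lia;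
  by apply: (subsetP sA); rewrite !inE eqxx ?orbT.
have [[a [b [ab bn eA cA Eab]]]|[a [b [w [r [[ab bw wn eA cA] so]]]]]] := member_cases AF.
  exists a, b; split=> //; last by rewrite eA.
  by rewrite ltnNge; apply: contraNN nE => lb; apply: (pairin_mono lcF Eab); lia.
exists a, b; split=> //; last by rewrite eA; apply/subsetP=> x; rewrite !inE => /orP[]->; rewrite ?orbT.
rewrite ltnNge; apply: contraNN nT => lb.
suff r0 : r = [::] by apply: (@triplein_mono _ _ lcF a b w); rewrite /triplein -?r0 -?eA //; lia.
by case: r so eA {cA} => // z r /= /andP[/andP[wz _] /andP[zn _]] _; lia.
Qed.

End Containment.

(** * The case of equality *)

Section Equality.
Variables (n l c : nat) (F : {set {set 'I_n}}).
Hypotheses (n_eq : n = 2 * l + 3 * c) (l_gt0 : 0 < l) (s_ge3 : 3 <= l + c).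
Hypotheses (nmF : nomatch F (l + c)) (upF : upset F) (lcF : left_closed F).
Hypothesis F1 : setof n [:: 0] \notin F.
Hypothesis nested : forall i, i < l -> pairin F i (2 * l - 1 - i).
Hypothesis nE : ~~ pairin F 0 n.-2.

(** If [{0, a}] with a = 2l + c - 1 were in [F], it could replace [{0, 2l - 1}]. The 3c points left
    over split into the triples 2l - 1 + p, a + 1 + p, a + 1 + c + p, all below the triple [Tt]. *)
Lemma full_triples_pairs : 1 < c -> triplein F (2 * l + (c - 2)) (n - 3) n.-1 ->
  ~~ pairin F 0 (2 * l + (c - 1)).
Proof.
move=> c_gt1 Tt; apply/negP=> Ea.
pose a := 2 * l + (c - 1).
have [i lti miss] := nomatch_col upF
  (fun x => if x == a then 0 else if x < l then x else if x < 2 * l - 1 then 2 * l - 1 - x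
    else if x < a then l + (x - (2 * l - 1)) else if x < a + 1 + c then l + (x - a - 1)
    else l + (x - a - 1 - c)) nmF.
have [i0|i_gt0] := posnP i.
  have /negP[] : setof n [:: 0; a] \notin F by apply: miss; apply/and3P; split=> //; rewrite /a; if_lia.
  exact: Ea.
have [il|li] := ltnP i l.
  have /negP[] : setof n [:: i; 2 * l - 1 - i] \notin F.
    by apply: miss; apply/and3P; split=> //; rewrite /a; if_lia.
  exact: nested.
pose p := i - l.
have /negP[] : ~~ triplein F (2 * l - 1 + p) (a + 1 + p) (a + 1 + c + p).
  by apply: miss; apply/and4P; split=> //; rewrite /a /p; if_lia.
by apply: (triplein_mono lcF Tt); rewrite /a /p; clear - n_eq lti li c_gt1 l_gt0; lia.
Qed.

(** The triple in question takes one class; the other c - 1 classes are 2l + p - 1, 2l + c + 1 + p,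
    2l + 2c + p with [p >= 1]. Their middle points reach 2l + 2c, which is at most [n - 3] only for
    [c > 2]; hence the separate treatment of [c = 2]. *)
Lemma full_triples_triples : 2 < c -> triplein F (2 * l + (c - 2)) (n - 3) n.-1 ->
  ~~ triplein F (2 * l + (c - 1)) (2 * l + c) (2 * l + c + 1).
Proof.
move=> c_gt2 Tt; apply/negP=> Ta.
have [p pc miss] := residual_missing n_eq l_gt0 nmF upF nested
  (fun x => if x < c - 1 then x + 1 else if x < c + 2 then 0
            else if x < c + 2 + (c - 1) then x - (c + 2) + 1 else x - (c + 2) - (c - 1) + 1).
have [p0|p_gt0] := posnP p.
  have : ~~ triplein F (2 * l + (c - 1)) (2 * l + c) (2 * l + (c + 1)).
    by apply: miss; rewrite ?p0; if_lia.
  by rewrite addnA Ta.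
have : ~~ triplein F (2 * l + (p - 1)) (2 * l + (c + 1 + p)) (2 * l + (c + p + c)).
  by apply: miss; if_lia.
by rewrite (triplein_mono lcF Tt) //; clear - n_eq c_gt2 p_gt0 pc; lia.
Qed.

(* Same as [residual_missing] with the roles of 2l-1 and 2l exchanged. *)
Lemma skew_missing (h : nat -> nat) : pairin F 0 (2 * l) -> exists2 p, p < c &
  forall u v w, u < v -> v < w -> w < 3 * c -> h u = p -> h v = p -> h w = p ->
    ~~ triplein F (2 * l + u - (u == 0)) (2 * l + v - (v == 0)) (2 * l + w - (w == 0)).
Proof.
move=> E0; pose r x := if x == 2 * l - 1 then 0 else x - 2 * l.
have [i lti miss] := nomatch_col upF
  (fun x => if x == 2 * l then 0 else if x < l then x else if x < 2 * l - 1 then 2 * l - 1 - x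
            else l + h (r x)) nmF.
have [i0|i_gt0] := posnP i.
  have /negP[] : setof n [:: 0; 2 * l] \notin F.
    by apply: miss; apply/and3P; split=> //; clear - l_gt0 i0; if_lia.
  exact: E0.
have [il|li] := ltnP i l.
  have /negP[] : setof n [:: i; 2 * l - 1 - i] \notin F.
    by apply: miss; apply/and3P; split=> //; clear - l_gt0 il i_gt0; if_lia.
  exact: nested.
have hR x : h x = i - l ->
    (if 2 * l + x - (x == 0) == 2 * l then 0 else if 2 * l + x - (x == 0) < l then 2 * l + x - (x == 0)
     else if 2 * l + x - (x == 0) < 2 * l - 1 then 2 * l - 1 - (2 * l + x - (x == 0))
     else l + h (r (2 * l + x - (x == 0)))) == i.
  have -> : r (2 * l + x - (x == 0)) = x.
    by rewrite /r; clear - l_gt0; case: posnP => [->|x0] /=; if_lia.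
  move=> ->; clear - l_gt0 li i_gt0; case: posnP => [->|x0] /=; if_lia.
exists (i - l) => [|u v w uv vw wc hu hv hw]; first by clear - lti li l_gt0; lia.
by apply: miss; apply/and4P; split=> //; apply: hR.
Qed.

Let S := npairs n.-2 (fun u v => ~~ triplein F u v n.-1) + npairs n.-2 (fun u v => ~~ triplein F u v n.-2).

Lemma missH_leq w :
  npairs n.-2 (fun u v => (2 * l <= u) && ~~ triplein F u v w) <= npairs n.-2 (fun u v => ~~ triplein F u v w).
Proof. by apply: leq_npairs => u v _ /andP[]. Qed.

Lemma equality_large : 2 < c -> S <= (2 * c - 1) * (2 * c - 2) -> F \subset famQ n (l + c) l.
Proof.
move=> c_gt2 Sle.
have Tt : triplein F (2 * l + (c - 2)) (n - 3) n.-1.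
  apply: contraTT Sle => nT; rewrite -ltnNge.
  apply: leq_trans (missH_bound_strict n_eq l_gt0 nmF upF lcF nested c_gt2 nT) _.
  by rewrite leq_add // missH_leq.
apply: sub_famQ => //.
- by lia.
- by clear - n_eq c_gt2; lia.
- rewrite (_ : _ - 1 = 2 * l + (c - 1)); last by clear - c_gt2; lia.
  by apply: full_triples_pairs => //; lia.
rewrite (_ : _ - 1 = 2 * l + (c - 1)); last by clear - c_gt2; lia.
rewrite (_ : l + c + l = 2 * l + c); last by clear; lia.
exact: full_triples_triples.
Qed.

(** Triples through both last points are invisible to the merging count [S], but they enter
    [count_direct]. *)
Lemma count_last_column m : m <= n.-2 ->
  (forall u, m <= u -> u < n.-2 -> ~~ triplein F u n.-2 n.-1) ->
  npairs n.-2 (fun u v => ~~ triplein F u v n.-1) + (n.-2 - m)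
    <= npairs n.-1 (fun u v => ~~ triplein F u v n.-1).
Proof.
move=> mn nT; have [n' en] : exists n', n.-1 = n'.+1 by exists n.-2; clear - n_eq l_gt0 s_ge3; lia.
have en' : n.-2 = n' by rewrite en.
rewrite en npairsS -en en' leq_add2l -en' -count_leq_iota.
rewrite -!size_filter; apply: uniq_leq_size => [|u]; first by rewrite filter_uniq ?iota_uniq.
by rewrite !mem_filter mem_iota => /andP[mu un]; rewrite un nT.
Qed.

Lemma equality_c2 : c = 2 -> S <= 6 -> F \subset famQ n (l + c) l \/ gt_min l c #|~: F|.
Proof.
move=> c2 Sle.
have n2 : n = 2 * l + 6 by clear - n_eq c2; lia.
have c_gt1 : 1 < c by rewrite c2.
have S6 : 6 <= S.
  have := missH_bound n_eq l_gt0 nmF upF lcF nested c_gt1; rewrite {1 2}c2 => h.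
  by apply: leq_trans h _; rewrite leq_add // missH_leq.
have miss_last u : ~~ triplein F (2 * l) (n - 2) (n - 1) -> 2 * l <= u -> u < n.-2 -> ~~ triplein F u n.-2 n.-1.
  by move=> nT lu un; apply: contraNN nT => h; apply: (triplein_mono lcF h); clear - n2 lu un; lia.
have tot : 1 + n + npairs n (fun u v => ~~ pairin F u v) + (npairs n.-1 (fun u v => ~~ triplein F u v n.-1)
    + npairs n.-2 (fun u v => ~~ triplein F u v n.-2)) <= #|~: F|.
  by apply: count_direct => //; clear - n2; lia.
(* [famQ] misses 12l + 32 sets when [c = 2]. Here at least 2l + 7 small sets, 12l + 15 pairs and 6 +
   4 triples are missing, 14l + 32 in all. *)
have small_pairs : ~~ pairin F 0 (2 * l) -> ~~ triplein F (2 * l) (n - 2) (n - 1) -> gt_min l c #|~: F|.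
  move=> nE0 nT; have h1 := count_missE lcF nE0 ltac:(clear - l_gt0; lia) ltac:(clear - n2; lia).
  have h2 := @count_last_column (2 * l) ltac:(clear - n2; lia) (fun u => miss_last u nT).
  move: h1 h2; rewrite (_ : n - 2 * l = 6) 1?(_ : _ - 2 * 0 = 4 * l + 5); try by clear - n2; lia.
  rewrite (_ : n.-2 - 2 * l = 4); last by clear - n2; lia.
  move=> h1 h2; apply: Or33; rewrite /boundQ c2.
  by move: tot S6 h1 h2; rewrite /S; clear - n2 l_gt0; lia.
have [Tt|nTt] := boolP (triplein F (2 * l) (n - 3) n.-1); last first.
  right; have nT2 : ~~ triplein F (2 * l) (n - 2) (n - 1).
    by apply: contraNN nTt => h; apply: (triplein_mono lcF h); clear - n2; lia.
  have [E0|nE0] := boolP (pairin F 0 (2 * l)); last exact: small_pairs.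
  exfalso; move: Sle; apply/negP; rewrite -ltnNge.
  (* In both cases [S] is at least 7. If this triple is present, the skew partition makes (2l - 1, n
     - 3, n - 1) missing, which [missH_bound] does not count. If not, three triples above it with
     [n - 2] and three with [n - 1] are missing, besides (2l, n - 3, n - 1). *)
  have [T4|nT4] := boolP (triplein F (2 * l + 1) (2 * l + 2) (2 * l + 4)).
    have nT5 : ~~ triplein F (2 * l - 1) (n - 3) n.-1.
      have [p pc miss] := skew_missing (fun x => if x \in [:: 0; 3; 5] then 0 else 1) E0.
      rewrite c2 in miss; have [p0|p_gt0] := posnP p.
        have := miss 0 3 5; rewrite p0 => /(_ isT isT isT erefl erefl erefl) /=.
        rewrite addn0 subn0 subn0 (_ : n - 3 = 2 * l + 3); last by clear - n2; lia.
        by rewrite (_ : n.-1 = 2 * l + 5) //; clear - n2; lia.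
      have p1 : p = 1 by clear - pc p_gt0 c2; lia.
      by have := miss 1 2 4; rewrite p1 !subn0 T4 => /(_ isT isT isT erefl erefl erefl).
    have := missH_bound n_eq l_gt0 nmF upF lcF nested c_gt1; rewrite {1 2}c2 => h.
    apply: leq_ltn_trans h _; rewrite -addSn leq_add ?missH_leq //.
    apply: (@ltn_npairs _ _ _ (2 * l - 1) (n - 3)) => [u v _ /andP[]||//|] //.
      by clear - n2; lia.
    by clear - l_gt0; lia.
  rewrite /S -(ltn_pmul2l (m := 2)) // mulnDr.
  have h1 := @count_missT n F lcF _ _ n.-2 _ nT4 ltac:(clear; lia) ltac:(clear; lia)
    ltac:(clear - n2; lia) ltac:(clear - n2; lia).
  move: h1; rewrite (_ : _ - (2 * l + 2) = 2) 1?(_ : _ - 2 * (2 * l + 1) = 3); try by clear - n2; lia.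
  move=> h1; have h2 : 6 < 2 * npairs n.-2 (fun u v => ~~ triplein F u v n.-1).
    have <- : (n.-2 - (2 * l + 2)) * (n.-2 + (2 * l + 2) - 1 - 2 * (2 * l + 1)) = 6.
      by rewrite (_ : _ - (2 * l + 2) = 2) 1?(_ : _ - 2 * (2 * l + 1) = 3) //; clear - n2; lia.
    rewrite -npairs_region_eq; [|by clear; lia|by clear - n2; lia].
    rewrite ltn_pmul2l //; apply: (@ltn_npairs _ _ _ (2 * l) (n - 3)).
    - move=> u v lt /andP[u1 v1].
      by apply: contraNN nT4 => h; apply: (triplein_mono lcF h); clear - u1 v1 lt n2; lia.
    - by clear - n2; lia.
    - by [].
    by clear; lia.
  by clear - h1 h2; lia.
have nEa : ~~ pairin F 0 (2 * l + 1).
  have := full_triples_pairs c_gt1; rewrite c2 /= addn0; apply; exact: Tt.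
have [T3|nT3] := boolP (triplein F (2 * l + 1) (2 * l + 2) (2 * l + 3)); last first.
  left; apply: sub_famQ => //.
  - by clear - c2 l_gt0; lia.
  - by clear - n2 c2; lia.
  - by rewrite (_ : _ - 1 = 2 * l + 1) //; clear - c2; lia.
  rewrite (_ : _ - 1 = 2 * l + 1); last by clear - c2; lia.
  rewrite (_ : l + c + l = 2 * l + 2); last by clear - c2; lia.
  by rewrite -addnA.
right.
have nT2 : ~~ triplein F (2 * l) (n - 2) (n - 1).
  have [p pc miss] := residual_missing n_eq l_gt0 nmF upF nested
    (fun x => if (x == 0) || (3 < x) then 1 else 0).
  rewrite c2 in miss; have [p0|p_gt0] := posnP p.
    by have := miss 1 2 3; rewrite p0 T3 => /(_ isT isT isT erefl erefl erefl).
  have p1 : p = 1 by clear - pc p_gt0 c2; lia.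
  have := miss 0 4 5; rewrite p1 => /(_ isT isT isT erefl erefl erefl).
  rewrite addn0 (_ : n - 2 = 2 * l + 4); last by clear - n2; lia.
  by rewrite (_ : n - 1 = 2 * l + 5) //; clear - n2; lia.
have [E0|nE0] := boolP (pairin F 0 (2 * l)); last exact: small_pairs.
have nT5 : ~~ triplein F (2 * l - 1) n.-2 n.-1.
  have [p pc miss] := skew_missing (fun x => if x \in [:: 0; 4; 5] then 0 else 1) E0.
  rewrite c2 in miss; have [p0|p_gt0] := posnP p.
    have := miss 0 4 5; rewrite p0 => /(_ isT isT isT erefl erefl erefl) /=.
    rewrite addn0 subn0 subn0 (_ : n.-2 = 2 * l + 4); last by clear - n2; lia.
    by rewrite (_ : n.-1 = 2 * l + 5) //; clear - n2; lia.
  have p1 : p = 1 by clear - pc p_gt0 c2; lia.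
  by have := miss 1 2 3; rewrite p1 !subn0 T3 => /(_ isT isT isT erefl erefl erefl).
have h1 := count_missE lcF nEa ltac:(clear - l_gt0; lia) ltac:(clear - n2; lia).
have h2 : npairs n.-2 (fun u v => ~~ triplein F u v n.-1) + (n.-2 - (2 * l - 1))
    <= npairs n.-1 (fun u v => ~~ triplein F u v n.-1).
  apply: count_last_column => [|u lu un]; first by clear - n2; lia.
  by apply: contraNN nT5 => h; apply: (triplein_mono lcF h); clear - n2 lu un; lia.
move: h1 h2; rewrite (_ : n - (2 * l + 1) = 5) 1?(_ : _ - 2 * 0 = 4 * l + 6); try by clear - n2; lia.
rewrite (_ : n.-2 - (2 * l - 1) = 5); last by clear - n2 l_gt0; lia.
(* The total is (2l + 7) + (10l + 15) + 6 + 5 = 12l + 33, one more than [famQ] misses. *)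
move=> h1 h2; apply: Or33; rewrite /boundQ c2.
by move: tot S6 h1 h2; rewrite /S; clear - n2 l_gt0; lia.
Qed.

(** If neither containment is immediate, let [x] be the last point with (x, n - 2, n - 1) in [F].
    Beside this triple the nested pairs on the other 2l points cannot all be in [F]; a missing one,
    [{u, w}], forces x + 2 missing pairs. With the 2l - x missing triples beyond [x] the total is at
    least 8l + 9, while [famQ] misses 8l + 8. *)
Lemma equality_c1 : c = 1 ->
  [\/ F \subset famQ n (l + c) l, F \subset famW n (l + c) l | gt_min l c #|~: F|].
Proof.
move=> c1; have n2 : n = 2 * l + 3 by clear - n_eq c1; lia.
have l_gt1 : 1 < l by clear - s_ge3 c1; lia.
have e1 : n.-2 = 2 * l + 1 by clear - n2; lia.
have e2 : n.-1 = 2 * l + 2 by clear - n2; lia.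
have nT3 : ~~ triplein F (2 * l) n.-2 n.-1.
  have c_gt0 : 0 < c by rewrite c1.
  have := last_triple_missing n_eq l_gt0 nmF upF lcF nested c_gt0.
  rewrite (_ : n - 3 = 2 * l) 1?(_ : n - 2 = n.-2) 1?(_ : n - 1 = n.-1) //; by clear - n2; lia.
have [T0|nT0] := boolP (triplein F 0 n.-2 n.-1); last first.
  by apply: Or32; apply: sub_famW => //; clear - n2 c1 l_gt0; lia.
have [E0|nE0] := boolP (pairin F 0 (2 * l)); last first.
  apply: Or31; apply: sub_famQ => //.
  - by clear - c1 l_gt0; lia.
  - by clear - n2 c1; lia.
  - by rewrite (_ : _ - 1 = 2 * l) //; clear - c1; lia.
  rewrite (_ : _ - 1 = 2 * l); last by clear - c1; lia.
  by rewrite (_ : l + c + l = n.-2) 1?(_ : n.-2 + 1 = n.-1) //; clear - c1 n2; lia.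
apply: Or33.
have ex : exists x, ~~ triplein F x n.-2 n.-1 by exists (2 * l).
case: (ex_minnP ex) => -[|x] nTx minx; first by rewrite T0 in nTx.
have Tx : triplein F x n.-2 n.-1 by apply: contraT => /minx; rewrite ltnn.
have xl : x < 2 * l by apply: minx.
have [u [w [uw wl nEuw hard]]] : exists u w, [/\ u < w, w <= 2 * l, ~~ pairin F u w &
    2 * x + 4 <= (2 * l + 1 - w) * (2 * l + w - 2 * u)].
  (* [r] numbers the points other than [x] below [n - 2] consecutively; [u] and [w] below are the
     points with numbers [i] and 2l - 1 - i. *)
  pose r v := if v < x then v else v - 1.
  have [i lti miss] := nomatch_col upF
    (fun v => if 2 * l < v then l else if v == x then l else if r v < l then r v else 2 * l - 1 - r v) nmF.
  have [il|li] := ltnP i l; last first.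
    have il : i = l by clear - lti li c1; lia.
    have /negP[] : ~~ triplein F x n.-2 n.-1; last exact: Tx.
    by apply: miss; rewrite e1 e2; apply/and4P; split=> //; clear - xl il; if_lia.
  pose u := if i < x then i else i.+1.
  pose w := if 2 * l - 1 - i < x then 2 * l - 1 - i else 2 * l - i.
  have ru : r u = i by rewrite /r /u; clear; case: (ltnP i x) => ?; if_lia.
  have rw : r w = 2 * l - 1 - i by rewrite /r /w; clear - il; case: (ltnP (2 * l - 1 - i) x) => ?; if_lia.
  have nEuw : ~~ pairin F u w.
    apply: miss; apply/and3P; split=> //.
      by rewrite ru /u; clear - il xl; case: (ltnP i x) => ?; if_lia.
    by rewrite rw /w; clear - il xl; case: (ltnP (2 * l - 1 - i) x) => ?; if_lia.
  have uw : u < w by rewrite /u /w; clear - il xl; if_lia.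
  have wl : w <= 2 * l by rewrite /w; clear - il; if_lia.
  have u_gt0 : 0 < u.
    rewrite lt0n; apply: contraNneq nEuw => u0; apply: (pairin_mono lcF E0); clear - wl uw n2 u0; lia.
  exists u, w; split=> //; move: u_gt0; rewrite /u /w.
  clear - il xl l_gt1; have [k lk] : exists k, l = i + 1 + k by exists (l - i - 1); lia.
  rewrite {}lk in il xl l_gt1 *.
  case: (ltnP i x) => ix; case: (ltnP (_ - i) x) => wx u_gt0; last 2 first.
  - by lia.
  - have -> : 2 * (i + 1 + k) + 1 - (2 * (i + 1 + k) - i) = i + 1 by lia.
    have -> : 2 * (i + 1 + k) + (2 * (i + 1 + k) - i) - 2 * i.+1 = 4 * k + i + 2 by lia.
    by nia.
  - have -> : 2 * (i + 1 + k) + 1 - (2 * (i + 1 + k) - 1 - i) = i + 2 by lia.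
    have -> : 2 * (i + 1 + k) + (2 * (i + 1 + k) - 1 - i) - 2 * i = 4 * k + i + 3 by lia.
    by nia.
  have -> : 2 * (i + 1 + k) + 1 - (2 * (i + 1 + k) - i) = i + 1 by lia.
  have -> : 2 * (i + 1 + k) + (2 * (i + 1 + k) - i) - 2 * i = 4 * k + i + 4 by lia.
  by nia.
have tot : 1 + n + npairs n (fun u v => ~~ pairin F u v) + (npairs n.-1 (fun u v => ~~ triplein F u v n.-1)
    + npairs n.-2 (fun u v => ~~ triplein F u v n.-2)) <= #|~: F|.
  by apply: count_direct => //; clear - n2; lia.
have colE b : n.-2 <= b -> b < n -> count (fun u => ~~ pairin F u b) (iota 0 b) = b.
  move=> nb bn; rewrite (eq_in_count (a2 := predT)) ?count_predT ?size_iota //= => v.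
  rewrite mem_iota => /= vb; apply: contraNN nE => h.
  by apply: (pairin_mono lcF h); clear - vb nb bn n2; lia.
have hE : npairs n (fun u v => ~~ pairin F u v) = npairs (2 * l + 1) (fun u v => ~~ pairin F u v) + (2 * l + 1) + (2 * l + 2).
  rewrite [X in npairs X _](_ : n = (2 * l + 1).+2); last by clear - n2; lia.
  rewrite !npairsS -[(2 * l + 1).+1]addn1 -addnA [2 * l + (1 + 1)]addnA -e1 !colE //; clear - n2 e1; lia.
have hT : npairs n.-2 (fun u v => ~~ triplein F u v n.-1) + (n.-2 - x.+1)
    <= npairs n.-1 (fun u v => ~~ triplein F u v n.-1).
  apply: count_last_column => [|v lv vn]; first by clear - n2 xl; lia.
  by apply: contraNN nTx => h; apply: (triplein_mono lcF h); clear - n2 lv vn; lia.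
have hR : (2 * l + 1 - w) * (2 * l + 1 + w - 1 - 2 * u) <= 2 * npairs (2 * l + 1) (fun u v => ~~ pairin F u v).
  apply: npairs_region_bound => [//||a b ua wb ab]; first by clear - wl; lia.
  by apply: contraNN nEuw => h; apply: (pairin_mono lcF h); clear - ua wb ab uw n2; lia.
move: hR; rewrite (_ : _ + w - 1 - 2 * u = 2 * l + w - 2 * u); last by clear; lia.
move=> /(leq_trans hard) hR.
apply: Or33; rewrite /boundQ c1; move: tot; rewrite hE; move: hT hR; clear - n2 xl l_gt1.
by rewrite (_ : n.-2 - x.+1 = 2 * l - x); lia.
Qed.

End Equality.

(** * The case analysis and the induction *)

Section Dichotomy.
Variables (n l c : nat) (F : {set {set 'I_n}}).
Hypotheses (n_eq : n = 2 * l + 3 * c) (l_gt0 : 0 < l) (s_ge3 : 3 <= l + c).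
Hypotheses (nmF : nomatch F (l + c)) (upF : upset F) (lcF : left_closed F).
Hypothesis maxF : forall G : {set {set 'I_n}}, nomatch G (l + c) -> #|G| <= #|F|.
Hypothesis IH : forall n' l' c' (F' : {set {set 'I_n'}}), n' < n -> n' = 2 * l' + 3 * c' ->
  0 < l' -> nomatch F' (l' + c') -> ge_min l' c' #|~: F'|.

Definition in_family := [|| F \subset famP n (l + c) l, F \subset famP' n (l + c) l,
  F \subset famQ n (l + c) l | F \subset famW n (l + c) l].

(** Bound and equality case share one case analysis: each branch gives strict excess or containment
    in one of the four families, while the induction supplies weak bounds only. *)
Lemma dichotomy : ge_min l c #|~: F| /\ (gt_min l c #|~: F| \/ in_family).
Proof.
have strict : gt_min l c #|~: F| -> ge_min l c #|~: F| /\ (gt_min l c #|~: F| \/ in_family).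
  by move=> sg; split; [apply: gt_minW | left].
have le2sn : 2 * (l + c) <= n by clear - n_eq; lia.
have s_gt0 : 0 < l + c by clear - l_gt0; lia.
have [F1|F1] := boolP (setof n [:: 0] \in F).
  apply: strict; apply: Or31; apply: leq_trans (boundP_exp l_gt0 s_ge3) _.
  have := singleton_missing_bound nmF upF lcF maxF le2sn s_gt0 F1.
  rewrite (_ : l + 2 * c + 2 = (n - (l + c) + 1).+1) ?expnS ?leq_pmul2l //.
  by clear - n_eq; lia.
have [/forallP nest|/forallPn[j nE]] := boolP [forall i : 'I_l, pairin F i (2 * l - 1 - i)]; last first.
  have bnd := not_nested_bound n_eq l_gt0 s_ge3 upF lcF F1 (ltn_ord j) nE.
  have jl := ltn_ord j.
  have [j0|j_gt0] := posnP j.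
    rewrite j0 in nE bnd; split.
      by apply: Or32; rewrite /boundP'; move: bnd; rewrite addn0 muln0 subn0.
    right; apply/or4P; apply: Or42; apply: sub_famP' => //; first by clear - n_eq l_gt0 s_ge3; lia.
    by rewrite subn0 in nE.
  have [j1|j1] := ltnP j (l - 1).
    by apply: strict; apply: interior_bound bnd.
  have j2 : val j = l - 1 by rewrite /=; clear - jl j1; lia.
  split.
    apply: Or31; rewrite /boundP; move: bnd; rewrite j2.
    rewrite (_ : 3 * c + 1 + (l - 1) = l + 3 * c); last by clear - l_gt0; lia.
    rewrite (_ : _ - 3 * (l - 1) = l + 3 * c + 1); last by clear - l_gt0; lia.
    by rewrite [(l + 3 * c) * _]mulnC.
  right; apply/or4P; apply: Or41; apply: sub_famP => //; first by clear - n_eq l_gt0 s_ge3; lia.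
  by move: nE; rewrite j2 (_ : 2 * l - 1 - (l - 1) = l) //; clear - l_gt0; lia.
have nested i : i < l -> pairin F i (2 * l - 1 - i) by move=> il; apply: (nest (Ordinal il)).
have c_gt0 : 0 < c.
  rewrite lt0n; apply/eqP=> c0; apply: (nomatch_nested nmF upF le2sn) => i.
  by rewrite c0 addn0; apply: nested.
have nT := last_triple_missing n_eq l_gt0 nmF upF lcF nested c_gt0.
have l1 v : ~~ pairin F (l - 1) v -> pairin F 0 v -> 1 < l.
  by move=> nE E0; rewrite ltn_neqAle l_gt0 andbT; apply: contraNneq nE => <-.
have [El|nEl] := boolP (pairin F (l - 1) n.-1); first by apply/strict/star_last.
have [E0|nE0] := boolP (pairin F 0 n.-1).
  by apply: strict; apply: remove_first_last => //; apply: l1 nEl E0.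
have [El'|nEl'] := boolP (pairin F (l - 1) n.-2); first by apply/strict/star_penult.
have [E0'|nE0'] := boolP (pairin F 0 n.-2).
  by apply: strict; apply: remove_first_penult => //; apply: l1 nEl' E0'.
have n_gt2 : 2 < n by clear - n_eq l_gt0 s_ge3; lia.
have [F' nmF' ineq] := merge_step n_gt2 upF lcF F1 nE0' nmF.
have [c' ec] : exists c', c = c'.+1 by exists c.-1; rewrite prednK.
have gd : ge_min l.+1 c' #|~: F'|.
  by apply: IH; [clear - n_gt2; lia | clear - n_eq ec; lia | | rewrite addSnnS -ec].
pose S := npairs n.-2 (fun u v => ~~ triplein F u v n.-1) + npairs n.-2 (fun u v => ~~ triplein F u v n.-2).
have inc S0 : S0 <= S -> #|~: F'| + (2 * n.-1 + S0) <= #|~: F|.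
  by move=> h; apply: leq_trans ineq; rewrite !leq_add2l.
have S_ge : (2 * c - 1) * (2 * c - 2) <= S.
  have [c_gt1|c_le1] := ltnP 1 c; last by rewrite (_ : c = 1) //; clear - c_gt0 c_le1; lia.
  apply: leq_trans (missH_bound n_eq l_gt0 nmF upF lcF nested c_gt1) _.
  by rewrite leq_add // missH_leq.
(* This is the growth of the number missing from [famQ] between [(l + 1, c')] and [(l, c' + 1)],
   where [s] is the same. *)
have eS : 2 * n.-1 + (2 * c - 1) * (2 * c - 2) = 4 * (l + c'.+1) + 4 * c'.+1 * c'.
  by clear - n_eq ec l_gt0; rewrite ec (_ : _ - 1 = 2 * c' + 1) 1?(_ : _ - 2 = 2 * c'); nia.
have s_ge3' : 3 <= l + c'.+1 by rewrite -ec.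
have [S_gt|S_le] := ltnP ((2 * c - 1) * (2 * c - 2)) S.
  apply: strict; rewrite ec; apply: gt_min_merge gd _ => //.
  by have := inc _ S_gt; rewrite addnS -addnA -eS addnS addnA.
split.
  rewrite [in ge_min _ _]ec; apply: ge_min_merge gd _ => //.
  by have := inc _ S_ge; rewrite eS addnA.
have [c_gt2|c_le2] := ltnP 2 c.
  by right; apply/or4P; apply: Or43; apply: equality_large.
have [c1|c1] := eqVneq c 1.
  have [h|h|h] := equality_c1 n_eq l_gt0 s_ge3 nmF upF lcF F1 nested nE0' c1.
  - by right; apply/or4P; apply: Or43.
  - by right; apply/or4P; apply: Or44.
  by left.
have c2 : c = 2 by clear - c1 c_gt0 c_le2; lia.
have S6 : S <= 6 by rewrite c2 in S_le.
have [h|h] := equality_c2 n_eq l_gt0 s_ge3 nmF upF lcF F1 nested nE0' c2 S6.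
  by right; apply/or4P; apply: Or43.
by left.
Qed.

End Dichotomy.

(** [F] is replaced by an extremal shifted family for the same parameters, so the induction
    hypothesis holds for the unstructured families produced by deletion and merging. *)
Lemma missing_bound n l c (F : {set {set 'I_n}}) : n = 2 * l + 3 * c -> 0 < l ->
  nomatch F (l + c) -> ge_min l c #|~: F|.
Proof.
elim/ltn_ind: n l c F => n IH l c F n_eq l_gt0 nmF.
have [lc3|lc3] := ltnP (l + c) 3; first exact: ge_min_small nmF.
have s_gt0 : 0 < l + c by lia.
have [G [nmG maxG upG lcG]] := extremal_exists n s_gt0.
apply: (@ge_min_leq _ _ #|~: G|).
  by have := maxG _ nmF; have := cardsC F; have := cardsC G; rewrite !card_sets; lia.
have IH' n' l' c' (F' : {set {set 'I_n'}}) : n' < n -> n' = 2 * l' + 3 * c' ->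
  0 < l' -> nomatch F' (l' + c') -> ge_min l' c' #|~: F'|.
  by move=> lt ? ? ?; apply: (IH _ lt).
by have [] := dichotomy n_eq l_gt0 lc3 nmG upG lcG maxG IH'.
Qed.

(** * The extremal families *)

Lemma card_itv n a m : m <= n -> #|itv n a.+1 m| = m - a.
Proof.
move=> mn; rewrite cardE -(size_map val) -[RHS](size_iota a).
apply/perm_size/uniq_perm; rewrite ?iota_uniq ?(map_inj_uniq val_inj) ?enum_uniq // => x.
rewrite mem_iota; apply/mapP/idP => [[y]|h].
  by rewrite mem_enum inE => h ->; rewrite /=; lia.
have xn : x < n by lia.
by exists (Ordinal xn); rewrite // mem_enum inE /=; lia.
Qed.

Lemma card_ksets n (X : {set 'I_n}) k : #|ksets X k| = 'C(#|X|, k).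
Proof. exact: cards_draws. Qed.

Lemma sum_blocks n (g : 'I_n -> nat) s (X : {set 'I_n}) :
  \sum_(i < s) #|[set x | g x == i] :&: X| <= #|X|.
Proof.
under eq_bigr => i _ do rewrite -sum1_card.
rewrite -[X in _ <= X]sum1_card.
rewrite (exchange_big_dep (fun x => x \in X)) /=; last by move=> i x _; rewrite inE => /andP[].
apply: leq_sum => x xX; rewrite sum1_card.
have [gs|sg] := ltnP (g x) s.
  rewrite (eq_card1 (x := Ordinal gs)) // => i.
  by rewrite -[LHS]/(x \in [set x | g x == i] :&: X) !inE xX andbT -val_eqE eq_sym.
rewrite eq_card0 // => i; rewrite -[LHS]/(x \in [set x | g x == i] :&: X) !inE xX andbT.
by have := ltn_ord i; lia.
Qed.

Lemma mul6_bin3 m : 6 * 'C(m, 3) = m * (m - 1) * (m - 2).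
Proof. by elim: m => // m IH; have := mul2_bin2 m; rewrite binS mulnDr IH; nia. Qed.

Section Families.
Variables (n l c : nat).
Hypotheses (n_eq : n = 2 * l + 3 * c) (l_gt0 : 0 < l) (s_gt0 : 0 < l + c).
Let s := l + c.

(** The weights of disjoint blocks add up to one less than needed: at most n + (l - 1) = 3s - 1 for
    [famP], n + (s + l - 1) = 4s - 1 for [famQ], and 2s - 1 for [famW]. *)
Lemma nomatch_weight (F : {set {set 'I_n}}) (wt : {set 'I_n} -> nat) k :
  (forall A, A \in F -> k <= wt A) ->
  (forall g : 'I_n -> nat, \sum_(i < s) wt [set x | g x == i] < s * k) ->
  nomatch F s.
Proof.
move=> ge lt g.
have [/forallP allF|/forallPn[i iF]] :=
  boolP [forall i : 'I_s, [set x | g x == i] \in F]; last by exists (val i); first exact: ltn_ord.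
have := lt g; rewrite ltnNge -[s in s * k]card_ord -sum_nat_const => /negP[].
by apply: leq_sum => i _; apply: ge.
Qed.

Let sum_size (g : 'I_n -> nat) : \sum_(i < s) #|[set x : 'I_n | g x == i]| <= n.
Proof.
have := sum_blocks g s setT; rewrite cardsT card_ord.
by under eq_bigr => i _ do rewrite setIT.
Qed.

Lemma nomatch_famP : nomatch (famP n s l) s.
Proof.
apply: (@nomatch_weight _ (fun A => #|A| + #|A :&: itv n 1 (l - 1)|) 3) => [A|g].
  by rewrite inE.
rewrite big_split /=.
apply: leq_ltn_trans (leq_add (sum_size g) (sum_blocks g s (itv n 1 (l - 1)))) _.
by rewrite card_itv /s; lia.
Qed.

Lemma nomatch_famW : nomatch (famW n s l) s.
Proof.
apply: (@nomatch_weight _ (fun A => #|A :&: itv n 1 (2 * s - 1)|) 2) => [A|g].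
  by rewrite inE.
apply: leq_ltn_trans (sum_blocks g s (itv n 1 (2 * s - 1))) _.
by rewrite card_itv /s; lia.
Qed.

Lemma nomatch_famQ : nomatch (famQ n s l) s.
Proof.
apply: (@nomatch_weight _ (fun A => #|A| + #|A :&: itv n 1 (s + l - 1)|) 4) => [A|g]; last first.
  rewrite big_split /=.
  apply: leq_ltn_trans (leq_add (sum_size g) (sum_blocks g s (itv n 1 (s + l - 1)))) _.
  by rewrite card_itv /s; lia.
rewrite !inE => /andP[nD /orP[/andP[_ A3]|/andP[sA /eqP A2]]]; last first.
  by move/setIidPl: sA => ->; rewrite A2.
have [A4|A4] := ltnP 3 #|A|; first by lia.
have cA : #|A| = 3 by lia.
rewrite cA -[4]/(3 + 1) leq_add2l card_gt0.
apply: contraNneq nD => A0; rewrite cA eqxx andbT; apply/subsetP=> x xA.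
have := in_set0 x; rewrite -A0 !inE xA /=.
by have := ltn_ord x; rewrite /s; lia.
Qed.

(** As n = 3s - l, at least [l] of [s] disjoint members would be pairs, but 2l - 1 points hold only
    l - 1 disjoint pairs. *)
Lemma nomatch_famP' : nomatch (famP' n s l) s.
Proof.
move=> g.
have [/forallP allF|/forallPn[i iF]] :=
  boolP [forall i : 'I_s, [set x | g x == i] \in famP' n s l]; last by exists (val i); first exact: ltn_ord.
exfalso; pose A (i : 'I_s) := [set x | g x == i].
have h1 (i : 'I_s) : 3 <= #|A i| + (#|A i| == 2).
  have := allF i; rewrite !inE -/(A i); case: (#|A i| =P 2) => [->|_] //.
  by rewrite andbF orbF addn0 => /andP[].
have h2 (i : 'I_s) : 2 * (#|A i| == 2) <= #|A i :&: itv n 1 (2 * l - 1)|.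
  case: (#|A i| =P 2) => [cA|_]; last by rewrite muln0.
  have := allF i; rewrite !inE -/(A i) cA andbF andbT => /setIidPl->.
  by rewrite cA.
have H1 : s * 3 <= n + \sum_(i < s) (#|A i| == 2).
  apply: leq_trans (leq_add (sum_size g) (leqnn _)); rewrite -big_split /=.
  by rewrite -[s in s * 3]card_ord -sum_nat_const; apply: leq_sum => i _; apply: h1.
have H2 : 2 * \sum_(i < s) (#|A i| == 2) <= 2 * l - 1.
  have <- : #|itv n 1 (2 * l - 1)| = 2 * l - 1 by rewrite card_itv; lia.
  apply: leq_trans (sum_blocks g s _); rewrite big_distrr /=.
  by apply: leq_sum => i _; apply: h2.
by move: H1 H2; rewrite /s; lia.
Qed.

Lemma card_missing_famP : 2 * #|~: famP n s l| <= boundP l c.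
Proof.
have sub : ~: famP n s l \subset
    ksets setT 0 :|: ksets setT 1 :|: ksets (~: itv n 1 (l - 1)) 2.
  apply/subsetP=> A; rewrite !inE !subsetT /= => A3.
  have [|A2] := ltnP #|A| 2; first by case: #|A| => [|[]].
  rewrite -leqNgt in A3.
  have := leq_trans (leq_add A2 (leqnn _)) A3.
  rewrite -[X in _ <= X]addn0 leq_add2l leqn0 => /eqP A0.
  have -> : #|A| == 2 by rewrite eqn_leq A2 andbT; rewrite A0 addn0 in A3.
  by rewrite andbT subsetC -disjoints_subset -setI_eq0 setIC -cards_eq0 A0 !orbT.
have cI : #|~: itv n 1 (l - 1)| = l + 3 * c + 1.
  by have := cardsC (itv n 1 (l - 1)); rewrite card_itv ?card_ord; lia.
have := subset_leq_card sub => h.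
have {h} := leq_trans h (leq_trans (leq_card_setU _ _) (leq_add (leq_card_setU _ _) (leqnn _))).
rewrite !card_ksets cardsT card_ord bin0 bin1 cI => h.
have := mul2_bin2 (l + 3 * c + 1); rewrite addnK /boundP => e2.
by move: h; rewrite -(leq_pmul2l (m := 2)) // !mulnDr e2 n_eq; clear; lia.
Qed.

Lemma card_missing_famP' : 2 * #|~: famP' n s l| <= boundP' l c.
Proof.
have sub : ~: famP' n s l \subset
    ksets setT 0 :|: ksets setT 1 :|: (ksets setT 2 :\: ksets (itv n 1 (2 * l - 1)) 2).
  apply/subsetP=> A; rewrite !inE itv_full !subsetT /= negb_or => /andP[A3 nA].
  by rewrite nA /=; case: #|A| A3 => [|[|[|]]].
have h := leq_trans (subset_leq_card sub) (leq_trans (leq_card_setU _ _)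
  (leq_add (leq_card_setU _ _) (leqnn _))).
have sub2 : ksets (itv n 1 (2 * l - 1)) 2 \subset ksets setT 2.
  by apply/subsetP=> A; rewrite !inE subsetT => /andP[].
move: h; rewrite cardsD (setIidPr sub2) !card_ksets cardsT card_ord bin0 bin1 card_itv; last by lia.
have := mul2_bin2 n; have := mul2_bin2 (2 * l - 1); rewrite subn0 /boundP'.
move: #|~: famP' n s l| 'C(2 * l - 1, 2) 'C(n, 2) => y B A hB; rewrite n_eq => hA h.
have [L eL] : exists L, l = L.+1 by exists l.-1; clear - l_gt0; lia.
clear - hA hB h eL; subst l.
have -> : 4 * L.+1 + 3 * c - 2 = 4 * L + 3 * c + 2 by lia.
move: hB; have -> : 2 * L.+1 - 1 = 2 * L + 1 by lia.
rewrite addnK => hB; move: hA; have -> : 2 * L.+1 + 3 * c - 1 = 2 * L + 3 * c + 1 by lia.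
by nia.
Qed.

Lemma card_missing_famQ : 3 * #|~: famQ n s l| <= boundQ l c.
Proof.
have sub : ~: famQ n s l \subset
    ksets setT 0 :|: ksets setT 1 :|: (ksets setT 2 :\: ksets (itv n 1 (s + l - 1)) 2)
    :|: ksets (itv n (s + l) n) 3.
  apply/subsetP=> A; rewrite !inE itv_full !subsetT /= !negb_and negb_or negbK.
  by case: (A \subset itv n 1 (s + l - 1)); case: (A \subset itv n (s + l) n);
     case: #|A| => [|[|[|[|]]]].
have h := leq_trans (subset_leq_card sub) (leq_trans (leq_card_setU _ _)
  (leq_add (leq_trans (leq_card_setU _ _) (leq_add (leq_card_setU _ _) (leqnn _))) (leqnn _))).
have sub2 : ksets (itv n 1 (s + l - 1)) 2 \subset ksets setT 2.
  by apply/subsetP=> A; rewrite !inE subsetT => /andP[].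
have e1 : #|itv n 1 (s + l - 1)| = 2 * l + c - 1 by rewrite card_itv /s; lia.
have e2 : #|itv n (s + l) n| = 2 * c + 1.
  by rewrite (_ : s + l = (s + l - 1).+1) ?card_itv //; rewrite /s; lia.
move: h; rewrite cardsD (setIidPr sub2) !card_ksets cardsT card_ord bin0 bin1 e1 e2.
have := mul2_bin2 n; have := mul2_bin2 (2 * l + c - 1); have := mul6_bin3 (2 * c + 1); rewrite /boundQ.
move: #|~: famQ n s l| 'C(2 * l + c - 1, 2) 'C(n, 2) 'C(2 * c + 1, 3) => y B A D hD hB.
rewrite n_eq => hA h.
have [L eL] : exists L, l = L.+1 by exists l.-1; clear - l_gt0; lia.
clear - hA hB hD h eL; subst l.
move: hB; have -> : 2 * L.+1 + c - 1 = 2 * L + c + 1 by lia.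
rewrite addnK => hB; move: hA; have -> : 2 * L.+1 + 3 * c - 1 = 2 * L + 3 * c + 1 by lia.
move: hD; rewrite addnK => hD hA.
case: c hA hB hD h => [|k] hA hB hD h; first by nia.
move: hD; have -> : 2 * k.+1 + 1 - 2 = 2 * k + 1 by lia.
have -> : k.+1 * k.+1 - 1 = k * (k + 2) by nia.
move=> hD; have eA : A = B + (2 * k + 3) * (2 * L + 2 * k + 3) by clear - hA hB; lia.
by move: h; rewrite eA addKn; clear - hD; lia.
Qed.

End Families.

(** * Families containing the empty set, and the conclusion *)

Lemma nomatch_add_star n s (F : {set {set 'I_n}}) (z : 'I_n) :
  nomatch F s -> nomatch (F :|: [set A : {set 'I_n} | z \in A]) s.+1.
Proof.
move=> nmF g.
have [i ltis iF] := nmF (fun x => if g x == g z then s else if g x == s then g z else g x).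
pose j := if i == g z then s else i.
have blk : [set x | (if g x == g z then s else if g x == s then g z else g x) == i] = [set x | g x == j].
  apply/setP=> x; rewrite !inE /j.
  by case: (g x =P g z) => ?; case: (g x =P s) => ?; case: (i =P g z) => ?; lia.
exists j; first by rewrite /j; case: ifP; lia.
rewrite blk in iF; rewrite !inE negb_or iF /j /=.
by case: (i =P g z) => ?; lia.
Qed.

(** Without [set0] the family has no s - 1 disjoint members, so it is no larger than an extremal [G]
    for s - 1. Adding to [G] all sets through the last point restores [s] and brings at least two
    new sets, [{n - 1}] and [{n - 2, n - 1}], against the single [set0]. *)
Lemma set0_not_extremal n s (F : {set {set 'I_n}}) : 1 < s -> 2 * s <= n ->
  nu F < s -> set0 \in F -> exists2 G : {set {set 'I_n}}, nomatch G s & #|F| < #|G|.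
Proof.
move=> s_gt1 le2sn nuF F0.
have nm1 : nomatch (F :\ set0) (s - 1).
  apply: nu_nomatch; first by rewrite !inE eqxx.
  suff : (nu (F :\ set0)).+1 <= nu F by lia.
  have [G] : exists2 G : {set {set 'I_n}}, (G \subset F :\ set0) && trivIset G & nu (F :\ set0) = #|G|.
    pose P (G : {set {set 'I_n}}) := (G \subset F :\ set0) && trivIset G.
    have P_gt0 : 0 < #|P|.
      apply/card_gt0P; exists set0; rewrite unfold_in /P sub0set /=.
      by apply/trivIsetP=> A B; rewrite inE.
    by have [G PG eG] := @eq_bigmax_cond _ P (fun G => #|G|) P_gt0; exists G.
  move=> /andP[/subsetD1P[sGF nG0] tG] ->.
  have -> : #|G|.+1 = #|set0 |: G| by rewrite cardsU1 nG0.
  have := @leq_bigmax_cond {set {set 'I_n}} (fun G => (G \subset F) && trivIset G)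
    (fun G : {set {set 'I_n}} => #|G|) (set0 |: G); apply.
  rewrite subUset sub1set F0 sGF /=.
  apply/trivIsetP=> A B; rewrite !inE => /orP[/eqP->|AG] /orP[/eqP->|BG]; rewrite ?eqxx // => AB.
  - by rewrite -setI_eq0 set0I.
  - by rewrite -setI_eq0 setI0.
  exact: (trivIsetP tG).
have s1 : 0 < s - 1 by lia.
have [G [nmG maxG upG lcG]] := extremal_exists n s1.
have zn : n.-1 < n by lia.
exists (G :|: [set A : {set 'I_n} | Ordinal zn \in A]).
  by have := nomatch_add_star (Ordinal zn) nmG; rewrite (_ : (s - 1).+1 = s) //; lia.
have zG : setof n [:: n.-1] \notin G by apply: last_notin nmG upG lcG _ s1; lia.
have EG : ~~ pairin G n.-2 n.-1.
  apply/negP=> h; apply: (nomatch_nested nmG upG); first by lia.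
  by move=> i ltis; apply: (pairin_mono lcG h); lia.
have sub : setof n [:: n.-1] |: (setof n [:: n.-2; n.-1] |: G) \subset
    G :|: [set A : {set 'I_n} | Ordinal zn \in A].
  by rewrite !subUset !sub1set !inE /= subsetUl !eqxx !orbT.
have := subset_leq_card sub; rewrite !cardsU1 !inE negb_or zG /= EG.
have -> : setof n [:: n.-1] != setof n [:: n.-2; n.-1].
  have z2n : n.-2 < n by lia.
  by apply/eqP => /setP/(_ (Ordinal z2n)); rewrite !inE /= eqxx; lia.
rewrite (cardsD1 set0 F) F0 => le; apply: leq_trans le; rewrite add1n !add1n !ltnS.
exact: maxG.
Qed.

Lemma shifted_left_closed n (F : {set {set 'I_n}}) : shifted F -> left_closed F.
Proof.
move=> shF i j A ltij AF jA iA.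
rewrite -(shF i j ltij) inE; apply/orP; left; apply/imsetP; exists A => //.
by rewrite /shift_set jA iA setUC.
Qed.

Theorem theorem3 (n s l c : nat)
    (hn0 : 0 < n) (hs0 : 0 < s) (hl0 : 0 < l) (hc0 : 0 < c)
    (hnc : n = 2 * s + c) (hnl : n = 3 * s - l)
    (hc : 1 <= c <= s - 1) (hl : 1 <= l <= s - 1) :
  e n s = maxn (maxn #|famP n s l| #|famP' n s l|)
               (maxn #|famQ n s l| #|famW n s l|)
  /\ (3 <= s ->
      forall F : {set {set 'I_n}},
        shifted F ->
        ~ (exists G : {set {set 'I_n}},
             [/\ G \subset F, trivIset G & #|G| = s]) ->
        #|F| = e n s ->
        [\/ F = famP n s l, F = famP' n s l, F = famQ n s l | F = famW n s l]).
Proof.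
have s_eq : s = l + c by lia.
have n_eq : n = 2 * l + 3 * c by lia.
have s_gt1 : 1 < s by lia.
have le2sn : 2 * s <= n by lia.
clear hnc hnl hc hl hn0; subst s.
have nm_le (G : {set {set 'I_n}}) : nomatch G (l + c) -> #|G| <= e n (l + c).
  move=> /nomatch_nu nuG.
  exact: (@leq_bigmax_cond {set {set 'I_n}} (fun F => nu F < l + c) (fun F : {set {set 'I_n}} => #|F|)).
have leP := nm_le _ (nomatch_famP n_eq hl0 hs0).
have leP' := nm_le _ (nomatch_famP' n_eq hl0 hs0).
have leQ := nm_le _ (nomatch_famQ n_eq hl0 hs0).
have leW := nm_le _ (nomatch_famW n_eq hl0 hs0).
have mP := card_missing_famP n_eq hl0 hs0.
have mP' := card_missing_famP' n_eq hl0 hs0.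
have mQ := card_missing_famQ n_eq hl0 hs0.
have cC (G : {set {set 'I_n}}) : #|G| + #|~: G| = 2 ^ n by rewrite cardsC card_sets.
split.
  apply/eqP; rewrite eqn_leq; apply/andP; split; last by rewrite !geq_max leP leP' leQ leW.
  apply/bigmax_leqP => F nuF.
  suff bnd (G : {set {set 'I_n}}) : nomatch G (l + c) -> #|G| <=
      maxn (maxn #|famP n (l + c) l| #|famP' n (l + c) l|) (maxn #|famQ n (l + c) l| #|famW n (l + c) l|).
    have [F0|F0] := boolP (set0 \in F); last exact/bnd/nu_nomatch.
    have [G /bnd nmG ltFG] := set0_not_extremal s_gt1 le2sn nuF F0.
    by apply: leq_trans nmG; apply: ltnW.
  move=> nmG; rewrite !leq_max; have := cC G.
  case: (missing_bound n_eq hl0 nmG) => h hG.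
  - by have := cC (famP n (l + c) l); rewrite -hG; lia.
  - by have := cC (famP' n (l + c) l); rewrite -hG; lia.
  - by have := cC (famQ n (l + c) l); rewrite -hG; lia.
move=> s_ge3 F shF noG cF.
have nuF : nu F < l + c.
  rewrite ltnNge; apply/negP=> le_s.
  pose P (G : {set {set 'I_n}}) := (G \subset F) && trivIset G.
  have P_gt0 : 0 < #|P|.
    apply/card_gt0P; exists set0; rewrite unfold_in /P sub0set /=.
    by apply/trivIsetP=> A B; rewrite inE.
  have [G /andP[sGF tG] eG] := @eq_bigmax_cond _ P (fun G => #|G|) P_gt0.
  have sz : size (take (l + c) (enum G)) = l + c.
    by rewrite size_takel // -cardE -eG.
  apply: noG; exists [set:: take (l + c) (enum G)].
  have sub : [set:: take (l + c) (enum G)] \subset G.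
    by apply/subsetP=> A; rewrite inE => /mem_take; rewrite mem_enum.
  split; [exact: subset_trans sub sGF | exact: trivIsetS sub tG |].
  by rewrite cardsE (card_uniqP _) // take_uniq ?enum_uniq.
have F0 : set0 \notin F.
  apply/negP=> F0; have [G /nm_le leG ltFG] := set0_not_extremal s_gt1 le2sn nuF F0.
  by have := leq_trans ltFG leG; rewrite cF ltnn.
have nmF := nu_nomatch F0 nuF.
have maxF (G : {set {set 'I_n}}) : nomatch G (l + c) -> #|G| <= #|F| by rewrite cF; apply: nm_le.
(* Maximality gives this directly: a missing superset of a member could be added. *)
have upF : upset F.
  move=> A B AF sAB; apply: contraT => BF.
  by have := maxF _ (nomatchU1 nmF AF sAB); rewrite cardsU1 BF ltnn.
have lcF := shifted_left_closed shF.
have IH n' l' c' (F' : {set {set 'I_n'}}) : n' < n -> n' = 2 * l' + 3 * c' ->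
    0 < l' -> nomatch F' (l' + c') -> ge_min l' c' #|~: F'|.
  by move=> _; apply: missing_bound.
have le_missing (X : {set {set 'I_n}}) : #|X| <= e n (l + c) -> #|~: F| <= #|~: X|.
  by rewrite -cF; have := cC F; have := cC X; lia.
have eq_family (X : {set {set 'I_n}}) : #|X| <= e n (l + c) -> F \subset X -> F = X.
  by move=> leX sFX; apply/eqP; rewrite eqEcard sFX cF.
have [_ [[h|h|h]|/or4P[h|h|h|h]]] := dichotomy n_eq hl0 s_ge3 nmF upF lcF maxF IH.
- by have := le_missing _ leP; lia.
- by have := le_missing _ leP'; lia.
- by have := le_missing _ leQ; lia.
- by apply: Or41; apply: eq_family.
- by apply: Or42; apply: eq_family.
- by apply: Or43; apply: eq_family.
by apply: Or44; apply: eq_family.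
Qed.
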